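(* Let $G$ be a just infinite profinite group that is not virtually pro-$p$ for any prime $p$, and let $\mathcal{C}$ be a class of finite simple groups such that condition $( ** )$ holds. Then there exist critical pairs $(R_n,S_n)$, $n \geq 0$, of $G$ with $R_{n+1} \le S_n$ and $\bigcap_n S_n = 1$, such that, setting $G_n = G/S_{n+1}$, $A_n = R_n/S_{n+1}$, $B_n = S_n/S_{n+1}$, $P_n = R_{n+1}/S_{n+1}$, and letting $\rho_n : G_{n+1}\to G_n$ be the natural quotient maps (so $P_n = \rho_n(A_{n+1})$ and $B_{n+1} = \ker\rho_n$), we have: $G \cong \varprojlim G_n$; for every $n$, $(A_n,B_n)$ is a critical pair in $G_n$, $A_n/B_n$ is a direct power of a group in $\mathcal{C}$, and $P_nC_{G_n}(P_n) \leq B_n$. If $G$ is moreover hereditarily just infinite, the pairs can additionally be chosen so that for every $n$, every subgroup of $G_n$ normalised by $A_n$ either contains $P_nC_{G_n}(P_n)$ or is contained in every maximal normal subgroup of $A_n$ (or both); and then no normal subgroup of $G_n$ containing $A_n$ is centrally decomposable.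
   Context: All groups are profinite, homomorphisms continuous, subgroups closed. A profinite group is \emph{just infinite} if it is infinite and every non-trivial closed normal subgroup has finite index; \emph{hereditarily just infinite} if moreover every open subgroup is just infinite. For normal subgroups $B<A$ of $G$, $(A,B)$ is a \emph{critical pair} in $G$ if $B$ contains every normal subgroup of $G$ properly contained in $A$. Condition $( ** )$ on $G$ and a class $\mathcal{C}$ of finite simple groups (possibly including cyclic groups of prime order): for every integer $n$ there is a finite continuous image $G/N$ of $G$ and a composition series of $G/N$ with at least $n$ factors in $\mathcal{C}$; and for every prime $p$, if $\mathcal{C}$ contains the cyclic group of order $p$ then $\mathcal{C}$ contains every non-abelian finite simple group whose Schur multiplier has order divisible by $p$. A finite group is a \emph{central product} of subgroups $\{H_i\}$ if they generate it and $[H_i,H_j]=1$ for $i\ne j$; it is \emph{centrally decomposable} if it is a central product of proper subgroups. *)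

(* Defs.v *)
From HB Require Import structures.
From mathcomp Require Import all_boot all_fingroup all_solvable.
From mathcomp Require Import boolp classical_sets cardinality topology.
Set Implicit Arguments. Unset Strict Implicit. Unset Printing Implicit Defensive.
Local Open Scope classical_set_scope.
Local Open Scope group_scope.

#[short(type="topGroupType")]
HB.structure Definition TopGroup := {G of monoid.Group G & Topological G}.

Section ProfiniteDefs.
Variable G : topGroupType.

Definition profinite : Prop :=
  continuous (fun p : (G * G)%type => p.1 * p.2) /\
  continuous (fun x : G => x^-1) /\
  compact [set: G] /\ hausdorff_space G /\ totally_disconnected [set: G].

Definition trivial_set : set G := [set 1].

Definition is_subgroup (H : set G) : Prop :=
  H 1 /\ (forall x y, H x -> H y -> H (x * y)) /\ (forall x, H x -> H x^-1).

Definition normalised_by (K H : set G) : Prop :=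
  forall k h, K k -> H h -> H (h ^ k).

Definition normal_in (N K : set G) : Prop :=
  is_subgroup N /\ N `<=` K /\ normalised_by K N.

Definition normal_sub (N : set G) : Prop := normal_in N [set: G].

(* In a profinite group "subgroup" means closed subgroup. *)
Definition closed_normal (N : set G) : Prop := normal_sub N /\ closed N.

Definition open_subgroup (H : set G) : Prop := is_subgroup H /\ open H.

Definition finite_index_in (K H : set G) : Prop :=
  exists s : seq G, forall h, H h -> exists2 x, x \in s & K (x^-1 * h).

Definition index_eq (K H : set G) (n : nat) : Prop :=
  exists s : seq G, size s = n /\
    (forall x, x \in s -> H x) /\
    (forall h, H h -> exists2 x, x \in s & K (x^-1 * h)) /\
    (forall i j, (i < n)%N -> (j < n)%N -> K ((nth 1 s i)^-1 * nth 1 s j) -> i = j).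

Definition just_infinite_sub (H : set G) : Prop :=
  infinite_set H /\
  forall N, normal_in N H -> closed N -> N <> trivial_set -> finite_index_in N H.

Definition just_infinite : Prop := just_infinite_sub [set: G].

(* every open subgroup is just infinite (open subgroups are closed, and the *)
(* closed subsets of an open subgroup H for the subspace topology are the   *)
(* closed subsets of G contained in H)                                       *)
Definition hereditarily_just_infinite : Prop :=
  just_infinite /\ forall H, open_subgroup H -> just_infinite_sub H.

Definition pro_p_sub (p : nat) (H : set G) : Prop :=
  forall N, normal_in N H -> open N -> exists k, index_eq N H (p ^ k)%N.

Definition virtually_pro_p (p : nat) : Prop :=
  exists H, open_subgroup H /\ pro_p_sub p H.

Definition critical_pair (A B : set G) : Prop :=
  closed_normal A /\ closed_normal B /\ B `<` A /\
  forall N, closed_normal N -> N `<` A -> N `<=` B.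

(* ---- Statements about the finite quotient G / K, phrased through the      *)
(* correspondence between subgroups of G/K and subgroups of G containing K.  *)

Definition critical_pair_mod (K A B : set G) : Prop :=
  normal_sub A /\ normal_sub B /\ K `<=` B /\ B `<` A /\
  forall N, normal_sub N -> K `<=` N -> N `<` A -> N `<=` B.

(* lift to G of the centraliser C_{G/K}(P/K) *)
Definition cent_mod (K P : set G) : set G :=
  [set g | forall x, P x -> K [~ g, x]].

Definition setmul (A B : set G) : set G := [set a * b | a in A & b in B].

Definition gen (X : set G) : set G :=
  [set g | forall H, is_subgroup H -> X `<=` H -> H g].

Definition quot_isog (Y X : set G) (gT : finGroupType) (T : {set gT}) : Prop :=
  exists f : G -> gT,
    (forall x y, Y x -> Y y -> f (x * y) = f x * f y) /\
    (forall t, t \in T <-> exists2 x, Y x & f x = t) /\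
    (forall x, Y x -> (f x = 1 <-> X x)).

Definition group_class := forall gT : finGroupType, {group gT} -> Prop.

Definition in_class (C : group_class) (gT : finGroupType) (H : {group gT}) : Prop :=
  exists (cT : finGroupType) (K : {group cT}), C cT K /\ (H \isog K).

Definition stem_extension (gT : finGroupType) (H : {group gT})
  (eT : finGroupType) (E Z : {group eT}) : Prop :=
  Z \subset 'Z(E) :&: E^`(1) /\ (E / Z \isog H)%g.

(* Schur's definition of the Schur multiplier order: the maximal order of   *)
(* the kernel of a stem extension (attained by the Schur covers).            *)
Definition schur_multiplier_order (gT : finGroupType) (H : {group gT}) (m : nat) : Prop :=
  (exists (eT : finGroupType) (E Z : {group eT}), stem_extension H E Z /\ #|Z| = m) /\
  (forall (eT : finGroupType) (E Z : {group eT}), stem_extension H E Z -> #|Z| <= m)%N.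

Definition schur_order_divisible (gT : finGroupType) (H : {group gT}) (p : nat) : Prop :=
  exists m, schur_multiplier_order H m /\ (p %| m)%N.

Definition factor_in_class (C : group_class) (Y X : set G) : Prop :=
  exists (cT : finGroupType) (T : {group cT}), C cT T /\ quot_isog Y X T.

Definition simple_factor (Y X : set G) : Prop :=
  normal_in X Y /\ X `<` Y /\
  forall M, normal_in M Y -> X `<=` M -> M `<` Y -> M = X.

Definition direct_power_of_class (C : group_class) (Y X : set G) : Prop :=
  exists (cT : finGroupType) (T : {group cT}), C cT T /\
  exists (dT : finGroupType) (D : {group dT}) (k : nat) (F : 'I_k -> {group dT}),
    \big[dprod/1]_(i < k) F i = D /\ (forall i, F i \isog T) /\ quot_isog Y X D.

Definition cond_starstar (C : group_class) : Prop :=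
  (forall n : nat, exists N, normal_sub N /\ open N /\
     exists (m : nat) (Y : nat -> set G),
       Y 0%N = N /\ Y m = [set: G] /\
       (forall i, (i < m)%N -> simple_factor (Y i.+1) (Y i)) /\
       exists idx : seq nat, uniq idx /\ (n <= size idx)%N /\
         forall i, i \in idx -> (i < m)%N /\ factor_in_class C (Y i.+1) (Y i)) /\
  (forall p, prime p ->
     (exists (cT : finGroupType) (K : {group cT}), C cT K /\ #|K| = p) ->
     forall (gT : finGroupType) (H : {group gT}),
       simple H -> ~~ abelian H -> schur_order_divisible H p -> in_class C H).

(* G is (naturally) isomorphic to the inverse limit of the G/S n.+1:         *)
(* the natural map G -> lim G/S_{n+1} is bijective and a homeomorphism, i.e.  *)
(* the S n are open and form a base of neighbourhoods of 1.                   *)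
Definition inverse_limit_iso (S : nat -> set G) : Prop :=
  (forall g, (forall n, S n.+1 g) -> g = 1) /\
  (forall c : nat -> G, (forall n, S n.+1 ((c n)^-1 * c n.+1)) ->
     exists g, forall n, S n.+1 ((c n)^-1 * g)) /\
  (forall n, open (S n.+1)) /\
  (forall U, open U -> U 1 -> exists n, S n.+1 `<=` U).

Definition good_series (C : group_class) (R S : nat -> set G) : Prop :=
  (forall n, critical_pair (R n) (S n)) /\
  (forall n, R n.+1 `<=` S n) /\
  \bigcap_n S n = trivial_set /\
  inverse_limit_iso S /\
  (forall n, critical_pair_mod (S n.+1) (R n) (S n)) /\
  (forall n, direct_power_of_class C (R n) (S n)) /\
  (forall n, setmul (R n.+1) (cent_mod (S n.+1) (R n.+1)) `<=` S n).

Definition hji_property (R S : nat -> set G) : Prop :=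
  forall n H, is_subgroup H -> S n.+1 `<=` H -> normalised_by (R n) H ->
    setmul (R n.+1) (cent_mod (S n.+1) (R n.+1)) `<=` H \/
    (forall M, normal_in M (R n) -> S n.+1 `<=` M -> M `<` R n ->
       (forall M', normal_in M' (R n) -> M `<=` M' -> M' `<` R n -> M' = M) ->
       H `<=` M).

Definition centrally_decomposable_mod (K N : set G) : Prop :=
  exists Hs : seq (set G),
    (forall H, H \in Hs -> is_subgroup H /\ K `<=` H /\ H `<` N) /\
    gen (K `|` \bigcup_(H in [set H | H \in Hs]) H) = N /\
    (forall i j, (i < size Hs)%N -> (j < size Hs)%N -> i <> j ->
       forall x y, nth set0 Hs i x -> nth set0 Hs j y -> K [~ x, y]).

Definition no_central_decomposition (R S : nat -> set G) : Prop :=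
  forall n N, normal_sub N -> R n `<=` N -> ~ centrally_decomposable_mod (S n.+1) N.

End ProfiniteDefs.

(* Main.v *)
Require Import Defs.
From HB Require Import structures.
From mathcomp Require Import all_boot all_fingroup all_solvable.
From mathcomp Require Import ssralg finalg boolp.

(* Obliquity: in a just infinite group, every closed normal subgroup that is   *)
(* not contained in a given open subgroup contains a fixed open normal         *)
(* subgroup [V]. Given an open normal [S], apply it to [S]: it then suffices   *)
(* to find a chief factor of [G] inside the intersection of [V] and [S], a     *)
(* power of a group of [C], that this intersection does not centralise. A      *)
(* minimal normal subgroup [R] covering it yields a critical pair [(R, S')]    *)
(* whose centraliser does not contain [V], hence lies in [S]; iterate.         *)
(*   Suppose that some open normal [U] centralises all the [C]-chief factors   *)
(* inside it. These are then abelian, and for a prime [p] of [C] no nonabelian *)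
(* simple group with Schur multiplier divisible by [p] occurs in [U]. Hence a  *)
(* topmost [p]-chief factor of the [p]-residual of [U] would split off, so     *)
(* there is none. The residual is open since [U] is not pro-[p], and so is the *)
(* intersection of these residuals over the primes of [C], as one sees from    *)
(* the [p0']-residual for one prime [p0]. This open normal subgroup has no     *)
(* [C]-factor, which contradicts the hypothesis on [G].                        *)
(*   When [G] is hereditarily just infinite, obliquity also holds for closed   *)
(* subgroups normalised by [R_n]; it is applied to the intersection of the     *)
(* maximal normal subgroups of [R_n], which is open, again by obliquity.       *)

(** The construction is the iteration, in [class_series], of a single step, [class_critical_below].
    [obliquity] reduces the requirement that a centraliser lie in [S] to the requirement that it not
    contain a certain open normal [V], so one element of [V] acting nontrivially on the chief factor
    is enough. [noncentral_class_chief] provides a chief factor on which such an element exists.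

    The latter is proved by contradiction ([central_contradiction]), and its core is finite group
    theory. If [U] centralises its chief factors in the class, a chief [p]-factor [F] in an image
    [E] of [O^p(U)] is central in [E]. A central [p]-subgroup can fail to split off from [O^p(E)]
    only because of a composition factor of order [p] above it, or of a nonabelian one whose Schur
    multiplier has order divisible by [p]: this is [central_p_residual], resting on
    [stem_kernel_dvd_schur]. The first kind is removed by induction. The second belongs to the class
    by [cond_starstar], yet would have to be abelian. So [F] splits off, which is impossible since
    [O^p(U)] has no proper [p]-quotient invariant under [G] ([no_p_chief_in_residual]). Some open
    normal subgroup is thus left without factors in the class, against [class_chief_below].

    In the hereditary case [hereditarily_open] extends obliquity to subgroups normalised only by an
    open normal subgroup, and [hji_step] builds the dichotomy into each step. Central
    indecomposability follows formally: a factor outside some maximal normal subgroup contains [P_n]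
    and its centraliser, hence every factor commuting with it ([hji_no_central_decomposition]). *)

Set Implicit Arguments.
Unset Strict Implicit.
Unset Printing Implicit Defensive.
Local Open Scope group_scope.

(** * Composition factors of chief factors *)

Section FiniteSections.

Implicit Types gT hT : finGroupType.

Lemma subnormal_simple gT (H G : {group gT}) :
  simple G -> H <|<| G -> H :=: 1 \/ H :=: G.
Proof.
move=> simG /subnormalEr[-> | [K [snK nKG prK]]]; first by right.
have [_ /(_ K nKG)[K1 | defK]] := simpleP _ simG.
  by left; apply/trivgP; rewrite -K1 subnormal_sub.
by move: prK; rewrite defK properxx.
Qed.

(** By simplicity [Y] covers [X / X'], and the second isomorphism theorem applies. *)
Lemma simple_factor_restrict gT (X X' Y : {group gT}) :
  X' <| X -> simple (X / X') -> Y <| X -> ~~ (Y \subset X') ->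
  X / X' \isog Y / (X' :&: Y).
Proof.
move=> nX'X simX nYX nsYX'.
have nX'Y : Y \subset 'N(X') := subset_trans (normal_sub nYX) (normal_norm nX'X).
have [_ /(_ (Y / X')%G)] := simpleP _ simX.
rewrite quotient_normal // => /(_ isT)[/trivgP | /= defYX].
  by rewrite quotient_sub1 // (negPf nsYX').
by rewrite -defYX isog_sym second_isog.
Qed.

(** A Jordan-Hölder matching: [X :&: A] covers [X / X'] by hypothesis, and covers [A / A'] because
    its image there is subnormal and nontrivial. The two kernels agree, so both factors are the same
    quotient of [X :&: A]. *)
Lemma simple_factors_isog gT (K A A' X X' : {group gT}) :
    A <| K -> A' <| K -> A' \subset A -> simple (A / A') ->
    X <|<| K -> X' <| X -> simple (X / X') ->
    ~~ (X :&: A \subset X') -> X :&: A' \subset X' ->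
  X / X' \isog A / A'.
Proof.
move=> nAK nA'K sA'A simA snXK nX'X simX nsXAX' sXA'X'.
have sXK := subnormal_sub snXK.
pose Y := (X :&: A)%G.
have nYX : Y <| X by rewrite /normal subsetIl normsI ?normG // (subset_trans sXK) ?normal_norm.
have nA'A : A \subset 'N(A') := subset_trans (normal_sub nAK) (normal_norm nA'K).
have nA'Y : Y \subset 'N(A') := subset_trans (subsetIr _ _) nA'A.
have snYA : Y <|<| A by exact: setI_subnormal (normal_sub nAK) snXK.
have /(subnormal_simple simA) := quotient_subnormal A' snYA.
case=> /= [/trivgP | defYA].
  rewrite quotient_sub1 // => sYA'; case/negP: nsXAX'.
  by apply: subset_trans sXA'X'; rewrite subsetI subsetIl.
have nX'Y_Y : X' :&: Y <| Y.
  by rewrite setIC; apply: normalGI nX'X; apply: subsetIl.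
(* Otherwise [X' :&: Y] already covers [A / A'], so each element of [Y] is one of [X' :&: Y] times
   one of [X :&: A'], and both factors lie in [X']. *)
have sX'Y : X' :&: Y \subset A'.
  have := quotient_normal A' nX'Y_Y; rewrite [_ / _ in X in _ <| X]defYA => nQ.
  have [_ /(_ ((X' :&: Y) / A')%G nQ)[/trivgP | /= defX'A]] := simpleP _ simA.
    by rewrite quotient_sub1 // (subset_trans (subsetIr _ _)).
  case/negP: nsXAX'; apply/subsetP=> x Yx.
  have: coset A' x \in (X' :&: Y) / A' by rewrite defX'A -defYA mem_quotient.
  case/morphimP=> y _ /setIP[X'y Yy] /= eq_xy.
  have Xx : x \in X by case/setIP: Yx.
  have Xy : y \in X by case/setIP: Yy.
  have: y^-1 * x \in A'.
    apply: coset_idr; first by rewrite groupM ?groupV ?(subsetP nA'Y).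
    by rewrite morphM ?morphV ?groupV ?(subsetP nA'Y) //= eq_xy mulVg.
  move=> A'yx; rewrite -(mulKVg y x) groupM // (subsetP sXA'X') // inE A'yx andbT.
  by rewrite groupM ?groupV.
have defI : X' :&: Y = A' :&: Y.
  apply/eqP; rewrite eqEsubset subsetI sX'Y subsetIr /= subsetI subsetIr andbT.
  by apply: subset_trans sXA'X'; rewrite setICA subsetI subsetIl setICA subsetIl.
apply: isog_trans (simple_factor_restrict nX'X simX nYX nsXAX') _.
by have := second_isog nA'Y; rewrite -defI defYA.
Qed.

(** [k = 0] is allowed, so the trivial group is a power of every [H]. *)
Definition direct_power gT (F : {group gT}) hT (H : {group hT}) : Prop :=
  exists (k : nat) (Fi : 'I_k -> {group gT}),
    \big[dprod/1]_(i < k) Fi i = F /\ (forall i, Fi i \isog H).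

Lemma charsimple_direct_power gT (F : {group gT}) : charsimple F ->
  exists H : {group gT}, [/\ H \subset F, simple H & direct_power F H].
Proof.
case/charsimple_dprod=> H [sHF simH [I AutI defF]]; exists H; split=> //.
pose Fi (i : 'I_#|I|) := (autm_morphism (subsetP AutI _ (enum_valP i)) @* H)%G.
exists #|I|, Fi; split=> [|i]; last first.
  by rewrite isog_sym sub_isog ?injm_autm.
rewrite -defF [RHS]big_enum_val; apply: eq_bigr => i _.
by rewrite /Fi /= morphimEsub.
Qed.

Lemma direct_power_isog gT (F : {group gT}) hT (H : {group hT})
    kT (K : {group kT}) :
  H \isog K -> direct_power F H -> direct_power F K.
Proof.
move=> isoHK [k [Fi [defF isoF]]]; exists k, Fi; split=> // i.
exact: isog_trans (isoF i) isoHK.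
Qed.

Lemma direct_power_component gT (F : {group gT}) k (Fi : 'I_k -> {group gT}) :
  \big[dprod/1]_(i < k) Fi i = F -> forall i, Fi i <| F.
Proof.
move=> defF i; move: defF; rewrite (bigD1 i) //= => /dprodP[[_ H _ ->]].
move=> <- cHH _; rewrite /normal mulG_subl /= mulG_subG normG /=.
exact: cents_norm.
Qed.

(* Take a minimal set [J] of components whose join meets [X] outside [X'].     *)
Lemma direct_power_factor gT (F : {group gT}) hT (H : {group hT})
    (X X' : {group gT}) :
    simple H -> direct_power F H -> X <|<| F -> X' <| X -> simple (X / X') ->
  X / X' \isog H.
Proof.
move=> simH [k [Fi [defF isoF]]] snX nX' simX.
have nFi := direct_power_component defF.
pose FJ (J : {set 'I_k}) := (\prod_(i in J) Fi i)%G.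
have nFJ J : FJ J <| F.
  rewrite /FJ; elim/big_rec: _ => [|i K _ nK]; first exact: normal1.
  by rewrite normalY.
have sFFJ : F \subset FJ [set: 'I_k].
  rewrite -(bigdprodWY defF) gen_subG; apply/bigcupsP=> i _.
  by rewrite /FJ (bigD1 i) ?inE //= joing_subl.
have ltX'X : ~~ (X \subset X').
  have [ntX _] := simpleP _ simX; apply: contra ntX => sXX'.
  by rewrite -subG1 quotient_sub1 // normal_norm.
pose P (J : {set 'I_k}) := ~~ (X :&: FJ J \subset X').
have PT : P [set: 'I_k].
  apply: contra ltX'X => sX; apply: subset_trans sX.
  by rewrite subsetIidl; apply: subset_trans (subnormal_sub snX) sFFJ.
case: (minset_exists PT) => J /minsetP[PJ minJ] _.
have [J0 | [j Jj]] := set_0Vmem J.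
  by case/negP: PJ; rewrite J0 /FJ big_set0 /= (subset_trans (subsetIr _ _)) ?sub1G.
pose J' := J :\ j.
have FJE : FJ J = (Fi j <*> FJ J')%G.
  by rewrite /FJ (big_setD1 j).
have sX' : X :&: FJ J' \subset X'.
  apply: contraT => PJ'; have := minJ _ PJ' (subD1set _ _).
  by move/setP/(_ j); rewrite !inE eqxx Jj.
have nJ'F : F \subset 'N(FJ J') by apply: normal_norm.
have nJ'j : Fi j \subset 'N(FJ J') by apply: subset_trans nJ'F; apply: normal_sub.
have simj : simple (Fi j) by rewrite (isog_simple (isoF j)).
have nIj : FJ J' :&: Fi j <| Fi j by rewrite /normal subsetIr normsI // normG.
have [_ /(_ _ nIj)[I1 | Ij]] := simpleP _ simj; last first.
  case/negP: PJ; rewrite FJE.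
  suff -> : (Fi j <*> FJ J' = FJ J')%G by [].
  by apply/group_inj/joing_idPr; rewrite -Ij subsetIl.
have sJ'J : FJ J' \subset FJ J by rewrite FJE joing_subr.
have quoJ : FJ J / FJ J' = Fi j / FJ J'.
  by rewrite FJE /= joingC quotientYidl.
have iso2 := second_isog nJ'j.
have isoj : FJ J / FJ J' \isog Fi j.
  rewrite quoJ isog_sym; apply: isog_trans iso2.
  by rewrite [_ :&: _]I1; apply: quotient1_isog.
apply: isog_trans (isoF j); apply: isog_trans (isoj).
apply: (@simple_factors_isog _ F) => //.
by rewrite (isog_simple isoj).
Qed.

(** Since [L] meets [Y] inside [Y'], Dedekind's law gives [Y' L :&: Y = Y'], and nothing is lost
    modulo [L]. *)
Lemma quotient_section_isog gT (Y Y' L : {group gT}) :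
    Y' <| Y -> Y \subset 'N(L) -> L :&: Y \subset Y' ->
  (Y / L) / (Y' / L) \isog Y / Y'.
Proof.
move=> nY'Y nLY sLYY'.
have nLY' : Y' \subset 'N(L) by apply: subset_trans (normal_sub nY'Y) nLY.
have nY'LY : Y \subset 'N(Y' <*> L) by rewrite normsY // normal_norm.
have nL : L <| Y <*> L by rewrite /normal joing_subr join_subG nLY normG.
have nY'L : Y' <*> L <| Y <*> L.
  rewrite /normal join_subG joing_subr (subset_trans (normal_sub nY'Y)) ?joing_subl //=.
  by rewrite join_subG nY'LY (subset_trans (joing_subr Y' L)) ?normG.
have /= := third_isog (joing_subr _ _) nL nY'L.
rewrite !quotientYidr // => iso3; apply: isog_trans iso3 _.
rewrite /=; have -> : (Y <*> L) / (Y' <*> L) = Y / (Y' <*> L).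
  rewrite -(quotientYidr nY'LY) /= joingA (joing_idPl (normal_sub nY'Y)) //.
have := second_isog nY'LY; rewrite isog_sym.
suff -> : (Y' <*> L) :&: Y = Y' by [].
rewrite norm_joinEl // -group_modl ?normal_sub //.
exact/mulGidPl.
Qed.

(** Take [K] minimal among the normal subgroups of [Q] between [Z] and [W] with [X :&: K] not inside
    [X'], and [L] maximal below [K]. Then [X :&: L] lies in [X'], so the section survives as a
    subnormal section of [K / L], and [direct_power_factor] identifies its type. *)
Lemma chief_factor_of_section gT (Q W Z X X' : {group gT}) :
    W <| Q -> Z <| Q -> Z \subset W -> X <|<| Q -> X \subset W ->
    Z \subset X' -> X' <| X -> simple (X / X') ->
  exists K L : {group gT},
    [/\ chief_factor Q L K, Z \subset L, K \subset W
      & direct_power (K / L)%G (X / X')%G].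
Proof.
move=> nWQ nZQ sZW snX sXW sZX' nX'X simX.
have ltX'X : ~~ (X \subset X').
  have [ntX _] := simpleP _ simX; apply: contra ntX => sXX'.
  by rewrite -subG1 quotient_sub1 // normal_norm.
pose P (A : {set gT}) := [&& A <| Q, Z \subset A, A \subset W & ~~ (X :&: A \subset X')].
have PW : P W by rewrite /P nWQ sZW subxx /= (setIidPl sXW).
case: (@mingroup_exists _ P W PW).
move=> K /mingroupP[/and4P[nKQ sZK sKW nsXK] minK] _.
have ltZK : Z \proper K.
  rewrite properEneq sZK andbT; apply: contraNneq nsXK => <-.
  exact: subset_trans (subsetIr _ _) sZX'.
have nZQ' := normal_norm nZQ.
have: (Z \proper K) && (Q \subset 'N(Z)) by rewrite ltZK.
case/(@maxgroup_exists _ (fun A => (A \proper K) && (Q \subset 'N(A))))=> L maxL sZL.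
have /maxgroupP[/andP[ltLK nLQ] _] := maxL.
have chiefKL : chief_factor Q L K by rewrite /chief_factor nKQ andbT; exact: maxL.
exists K, L; split=> //.
have sLK := proper_sub ltLK.
have nLK_Q : L <| Q by rewrite /normal nLQ (subset_trans sLK) ?normal_sub.
have nLK : L <| K by apply: normalS (normal_sub nKQ) nLK_Q.
have sXL : X :&: L \subset X'.
  apply: contraT => nsXL.
  have: K \subset L by rewrite (minK L) // /P nLK_Q sZL (subset_trans sLK sKW).
  by rewrite (negPf (proper_subn ltLK)).
have [H [sHF simH powF]] := charsimple_direct_power
  (minnormal_charsimple (chief_factor_minnormal chiefKL)).
apply: direct_power_isog (powF).
pose Y := (X :&: K)%G; pose Y' := (X' :&: Y)%G.
have sXQ := subnormal_sub snX.
have nYX : Y <| X.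
  by rewrite /normal subsetIl normsI ?normG // (subset_trans sXQ) ?normal_norm.
have nY'Y : Y' <| Y.
  by rewrite /= setIC; apply: normalGI nX'X; apply: subsetIl.
have isoXY : X / X' \isog Y / Y' := simple_factor_restrict nX'X simX nYX nsXK.
have simY : simple (Y / Y') by rewrite -(isog_simple isoXY).
have snYK : Y <|<| K by apply: setI_subnormal (normal_sub nKQ) snX.
have nLY : Y \subset 'N(L) by apply: subset_trans (subsetIr _ _) (normal_norm nLK).
have sLYY' : L :&: Y \subset Y'.
  rewrite subsetI subsetIr andbT; apply: subset_trans sXL.
  by rewrite subsetI subsetIl andbT (subset_trans (subsetIr _ _)) ?subsetIl.
have isoL : (Y / L) / (Y' / L) \isog Y / Y' by apply: quotient_section_isog.
have nQL : Y' / L <| Y / L by apply: quotient_normal.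
have simQ : simple ((Y / L) / (Y' / L)) by rewrite (isog_simple isoL).
have snYL : Y / L <|<| K / L by apply: quotient_subnormal.
have isoH := direct_power_factor simH powF snYL nQL simQ.
rewrite isog_sym; apply: isog_trans isoXY _; apply: isog_trans isoH.
by rewrite isog_sym.
Qed.

End FiniteSections.

(** * Stem extensions of perfect groups *)

Section SchurMultiplier.

Implicit Types gT eT : finGroupType.

(** A central factor disappears from a commutator, on the left entry and then, by inverting, on the
    right one. *)
Lemma der1_central_mul gT (E D Z : {group gT}) :
  Z \subset 'C(E) -> D \subset E -> E \subset D * Z -> E^`(1) = D^`(1).
Proof.
move=> cZE sDE sEDZ; apply/eqP; rewrite eqEsubset andbC dergS //=.
have comE u v : u \in E -> v \in E -> exists2 w, w \in D & [~ u, v] = [~ w, v].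
  move=> Eu Ev; have /mulsgP[w z Dw Zz ->] := subsetP sEDZ u Eu; exists w => //.
  have czE : {in E, forall y, commute z y} by apply/centP/(subsetP cZE).
  rewrite commMgJ; have /commgP/eqP-> := czE v Ev; rewrite mulg1.
  have Ewv : [~ w, v] \in E by rewrite groupR // (subsetP sDE).
  by rewrite /conjg -(czE _ Ewv) mulKg.
rewrite gen_subG; apply/subsetP=> _ /imset2P[u v Eu Ev ->].
have [w Dw ->] := comE u v Eu Ev; have Ew := subsetP sDE w Dw.
rewrite -invg_comm groupV; have [x Dx ->] := comE v w Ev Ew.
exact: mem_commg.
Qed.

(** On a central subgroup of index [n] the transfer is [z |-> z ^+ n], and a perfect group has
    trivial transfer into an abelian group. *)
Lemma central_transfer_exp eT (E Z : {group eT}) :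
  Z \subset 'Z(E) -> E^`(1) = E -> {in Z, forall z, z ^+ #|E : Z| = 1}.
Proof.
rewrite subsetI => /andP[sZE cZE] pE z Zz.
have cZ : abelian Z by rewrite /abelian (subset_trans sZE) // centsC.
have abA : abelian (idm_morphism Z @* Z) by rewrite im_idm.
have := morphim_der (transfer_morphism E abA) 1 (subxx E).
rewrite pE (derG1P (FinRing.zmod_abelian _)) => tE1.
have : transfer E abA z \in transfer_morphism E abA @* E.
  by rewrite mem_morphim // (subsetP sZE).
rewrite tE1 => /set1P; rewrite /transfer.
rewrite (eq_bigr (fun _ => FiniteModule.fmod abA z)); last first.
  move=> _ /rcosetsP[x Ex ->]; rewrite /restrm /=; congr (FiniteModule.fmod _ _).
  have cz y : y \in E -> z * y = y * z by move=> Ey; apply: (centP (subsetP cZE z Zz)).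
  have -> : Z :* x :* z = Z :* x.
    by rewrite -rcosetM -(cz x) // rcosetM (rcoset_id Zz).
  rewrite -(cz (repr _)) ?mulgK //.
  have := mem_repr_rcoset Z x; apply: subsetP.
  by rewrite mul_subG // sub1set.
rewrite GRing.sumr_const => tz0.
have Az : z \in idm_morphism Z @* Z by rewrite im_idm.
by rewrite -(FiniteModule.fmodK abA (groupX _ Az)) FiniteModule.fmodX // tz0.
Qed.

Lemma abelian_gen_card eT n (S : {set eT}) :
  (0 < n)%N -> abelian <<S>> -> {in S, forall x, x ^+ n = 1} ->
  (#|<<S>>| <= n ^ #|S|)%N.
Proof.
move=> n_gt0; move: {2}#|S| (leqnn #|S|) => m; elim: m S => [|m IHm] S.
  by rewrite leqn0 cards_eq0 => /eqP-> _ _; rewrite gen0 cards0 cards1.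
move=> leSm abS expS; have [-> | [x Sx]] := set_0Vmem S.
  by rewrite gen0 cards0 cards1.
have sS'S : S :\ x \subset S := subD1set S x.
have card_S : #|S| = #|S :\ x|.+1 by rewrite (cardsD1 x) Sx.
have sxS : <[x]> \subset <<S>> by rewrite cycle_subG mem_gen.
have defS : <<S>> = <[x]> * <<S :\ x>>.
  rewrite -cent_joinEl; last first.
    by rewrite (subset_trans sxS) // (subset_trans abS) // centS // genS.
  by rewrite /= /cycle joing_idl joing_idr -[in LHS](setD1K Sx).
rewrite card_S expnS defS.
have := mul_cardG <[x]> <<S :\ x>>; set c := #|_ :&: _| => eq_c.
have c_gt0 : (0 < c)%N by apply: cardG_gt0.
apply: leq_trans (_ : #|<[x]>| * #|<<S :\ x>>| <= _)%N.
  by rewrite eq_c leq_pmulr.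
apply: leq_mul.
  by apply: dvdn_leq => //; rewrite order_dvdn expS.
apply: IHm; first by rewrite -ltnS -card_S.
  by rewrite (abelianS _ abS) ?genS.
by move=> y /(subsetP sS'S); apply: expS.
Qed.

Lemma stem_perfect gT (H : {group gT}) eT (E Z : {group eT}) :
  H^`(1) = H -> stem_extension H E Z -> E^`(1) = E.
Proof.
move=> pH []; rewrite subsetI => /andP[sZZ sZE'] isoH.
have nZE := normal_norm (sub_center_normal sZZ).
have pQ : (E / Z)^`(1) = E / Z.
  have /isogP[f injf fH] : H \isog E / Z by rewrite isog_sym.
  by rewrite -fH -morphim_der // pH.
apply/eqP; rewrite eqEsubset der_sub /=.
by rewrite -(quotientSGK nZE sZE') quotient_der // pQ.
Qed.

(** The bound ensures that a stem kernel of largest order exists. The transfer bounds the exponent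
    of [Z] by [#|H|], and [Z] is generated by the values of the factor set of a transversal, at most
    [#|H| * #|H|] in number. *)
Lemma stem_kernel_bound gT (H : {group gT}) eT (E Z : {group eT}) :
  H^`(1) = H -> stem_extension H E Z ->
  (#|Z| <= #|H| ^ (#|H| * #|H|))%N.
Proof.
move=> pH stemE; have pE := stem_perfect pH stemE.
case: stemE; rewrite subsetI => /andP[sZZ _] isoH.
have expZ := central_transfer_exp sZZ pE.
have /andP[sZE nZE] := sub_center_normal sZZ.
have cZE : Z \subset 'C(E) by apply: subset_trans sZZ (subsetIr _ _).
have nE : #|E : Z| = #|H| by rewrite -card_quotient // (card_isog isoH).
pose R := rcosets Z E.
pose t (A : {set eT}) := repr A.
pose C0 := [set t A * t B * (t (A * B))^-1 | A in R, B in R].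
have R_E x : x \in E -> Z :* x \in R by move=> Ex; apply/rcosetsP; exists x.
have tP x : x \in E -> t (Z :* x) \in E /\ t (Z :* x) * x^-1 \in Z.
  move=> Ex; have := mem_repr_rcoset Z x; rewrite -/(t _) => tx.
  by split; [apply: subsetP tx; rewrite mul_subG ?sub1set | rewrite -mem_rcoset].
have ct x : x \in E -> coset Z (t (Z :* x)) = coset Z x.
  move=> Ex; have [Et Zt] := tP _ Ex.
  rewrite -[t _](mulgKV x) morphM ?(subsetP nZE) ?groupM ?groupV //=.
  by rewrite coset_id // mul1g.
have sC0Z : C0 \subset Z.
  apply/subsetP=> _ /imset2P[_ _ /rcosetsP[x Ex ->] /rcosetsP[y Ey ->] ->].
  rewrite rcoset_mul ?(subsetP nZE) //.
  have [Et _] := tP _ (groupM Ex Ey); have [Etx _] := tP _ Ex; have [Ety _] := tP _ Ey.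
  have Nt := subsetP nZE; apply: coset_idr; first by rewrite !groupM ?groupV ?Nt.
  rewrite morphM ?morphV ?groupM ?groupV ?Nt //= morphM ?Nt //=.
  by rewrite !ct ?groupM // morphM ?Nt // mulgV.
pose K := <<C0>>%G.
have sKZ : K \subset Z by rewrite gen_subG.
have abK : abelian K.
  by rewrite /abelian (subset_trans sKZ) // (subset_trans cZE) // centS // (subset_trans sKZ).
have leC0 : (#|C0| <= #|H| * #|H|)%N.
  rewrite -nE /C0 curry_imset2X; apply: leq_trans (leq_imset_card _ _) _.
  by rewrite cardsX.
suff defK : Z \subset K.
  apply: leq_trans (subset_leq_card defK) _.
  apply: leq_trans (abelian_gen_card (cardG_gt0 H) abK _) _.
    by move=> x /(subsetP sC0Z) Zx; rewrite -nE expZ.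
  by rewrite leq_pexp2l ?cardG_gt0.
(* [K] times the transversal is a group. It contains all commutators of [E], as these depend only on
   cosets of [Z], and so contains the perfect group [E]. *)
pose M := K * [set t A | A in R].
have cK k e : k \in K -> e \in E -> commute k e.
  by move=> Kk Ee; apply: (centP (subsetP cZE _ (subsetP sKZ _ Kk))).
have Rm A B : A \in R -> B \in R -> A * B \in R.
  case/rcosetsP=> x Ex -> /rcosetsP[y Ey ->]; rewrite rcoset_mul ?(subsetP nZE) //.
  by rewrite R_E ?groupM.
have t_E A : A \in R -> t A \in E by case/rcosetsP=> x Ex ->; case: (tP x Ex).
have gM : group_set M.
  apply/group_setP; split.
    rewrite -[1]mulg1 mem_mulg ?group1 // -(repr_group Z) -[Z : {set _}]rcoset1.
    exact/imset_f/R_E.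
  move=> _ _ /mulsgP[k _ Kk /imsetP[A RA ->] ->] /mulsgP[l _ Kl /imsetP[B RB ->] ->].
  have -> : k * t A * (l * t B) = k * l * (t A * t B * (t (A * B))^-1) * t (A * B).
    by rewrite -!mulgA mulVg mulg1 (mulgA (t A)) -(cK l) ?t_E // !mulgA.
  apply: mem_mulg; last by apply/imset_f/Rm.
  by apply: groupM; [apply: groupM | apply: mem_gen; apply/imset2P; exists A B].
have tM A : A \in R -> t A \in M by move=> RA; rewrite -[t A]mul1g mem_mulg ?imset_f.
have sE'M : E \subset Group gM.
  rewrite -pE gen_subG; apply/subsetP=> _ /imset2P[x y Ex Ey ->].
  have [Etx Ztx] := tP _ Ex; have [Ety Zty] := tP _ Ey.
  have cz z e : z \in Z -> e \in E -> [~ z, e] = 1.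
    by move=> Zz Ee; apply/eqP/commgP; apply: (centP (subsetP cZE _ Zz)).
  have eqc z a b : z \in Z -> a \in E -> b \in E -> [~ z * a, b] = [~ a, b].
    by move=> Zz Ea Eb; rewrite commMgJ (cz z b Zz Eb) conj1g mul1g.
  have eqc' z a b : z \in Z -> a \in E -> b \in E -> [~ a, z * b] = [~ a, b].
    by move=> Zz Ea Eb; rewrite -invg_comm eqc // invg_comm.
  have -> : [~ x, y] = [~ t (Z :* x), t (Z :* y)].
    have -> : [~ x, y] = [~ t (Z :* x) * x^-1 * x, t (Z :* y) * y^-1 * y].
      by rewrite eqc' ?eqc // mulgKV.
    by rewrite !mulgKV.
  by rewrite groupR //= tM // R_E.
(* Writing [z = k * t (Z :* x)] forces [x] into [Z], and the representative of the trivial coset is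
   [1]. *)
apply/subsetP=> z Zz; have := subsetP sE'M z (subsetP sZE z Zz).
case/mulsgP=> k _ Kk /imsetP[_ /rcosetsP[x Ex ->] ->] defz.
have [_ Ztx] := tP _ Ex.
have Zt : t (Z :* x) \in Z.
  by rewrite -[t _](mulKg k) -defz groupM ?groupV // (subsetP sKZ).
have Zx : x \in Z by rewrite -groupV -[x^-1](mulKg (t (Z :* x))) groupM ?groupV.
by rewrite defz rcoset_id // /t repr_group mulg1.
Qed.

Lemma stem_morphism gT (H : {group gT}) eT (E Z : {group eT}) :
  stem_extension H E Z ->
  exists2 f : {morphism E >-> gT}, f @* E = H & 'ker f = Z.
Proof.
case; rewrite subsetI => /andP[sZZ _] /isogP[i injI iE].
have /andP[sZE nZE] := sub_center_normal sZZ.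
pose f x := i (coset Z x).
have fM : {in E &, {morph f : x y / x * y}}.
  by move=> x y Ex Ey; rewrite /f morphM ?(subsetP nZE) // morphM ?mem_quotient.
exists (Morphism fM).
  apply/setP=> y; rewrite -iE.
  apply/morphimP/morphimP=> [[x _ Ex ->] | [_ _ /morphimP[x _ Ex ->] ->]].
    by exists (coset Z x); rewrite ?mem_quotient.
  by exists x.
apply/setP=> x; apply/idP/idP=> [kx | Zx].
  have Ex := dom_ker kx; have := mker kx; rewrite /= /f -(morph1 i).
  move/(injmP injI); rewrite mem_quotient // group1 => /(_ isT isT).
  by apply: coset_idr; rewrite (subsetP nZE).
by apply/kerP; rewrite ?(subsetP sZE) //= /f coset_id // morph1.
Qed.

(* The cover is the derived subgroup of the fibre product over [H].            *)
Lemma stem_common_cover gT (H : {group gT}) eT1 (E1 Z1 : {group eT1})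
    eT2 (E2 Z2 : {group eT2}) :
    H^`(1) = H -> stem_extension H E1 Z1 -> stem_extension H E2 Z2 ->
  exists (eT : finGroupType) (E Z : {group eT}),
    [/\ stem_extension H E Z, #|Z1| %| #|Z| & #|Z2| %| #|Z|]%N.
Proof.
move=> pH stem1 stem2.
have pE1 := stem_perfect pH stem1; have pE2 := stem_perfect pH stem2.
have [f1 f1E kf1] := stem_morphism stem1; have [f2 f2E kf2] := stem_morphism stem2.
case: stem1 => /subsetIP[/subsetIP[sZE1 cZE1] _] _.
case: stem2 => /subsetIP[/subsetIP[sZE2 cZE2] _] _.
pose P := [set u : eT1 * eT2 | [&& u.1 \in E1, u.2 \in E2 & f1 u.1 == f2 u.2]].
have gP : group_set P.
  apply/group_setP; split; first by rewrite inE !group1 !morph1 eqxx.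
  move=> u v; rewrite !inE => /and3P[u1 u2 /eqP fu] /and3P[v1 v2 /eqP fv].
  by rewrite !groupM // !morphM // fu fv eqxx.
pose PG := Group gP.
have inP u : u \in PG -> [/\ u.1 \in E1, u.2 \in E2 & f1 u.1 = f2 u.2].
  by rewrite inE => /and3P[? ? /eqP].
pose psi (u : eT1 * eT2) := f1 u.1.
have psiM : {in PG &, {morph psi : u v / u * v}}.
  by move=> u v /inP[u1 _ _] /inP[v1 _ _]; rewrite /psi morphM.
pose psim := Morphism psiM.
have fst1 : fst_morphism eT1 eT2 @* PG = E1.
  apply/setP=> x; apply/morphimP/idP=> [[u _ /inP[u1 _ _] ->] // | Ex].
  have: f1 x \in f2 @* E2 by rewrite f2E -f1E mem_morphim.
  case/morphimP=> y _ Ey fxy; exists (x, y); rewrite ?inE //=.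
  by rewrite Ex Ey fxy eqxx.
have snd2 : snd_morphism eT1 eT2 @* PG = E2.
  apply/setP=> y; apply/morphimP/idP=> [[u _ /inP[_ u2 _] ->] // | Ey].
  have: f2 y \in f1 @* E1 by rewrite f1E -f2E mem_morphim.
  case/morphimP=> x _ Ex fxy; exists (x, y); rewrite ?inE //=.
  by rewrite Ex Ey fxy eqxx.
have psiP : psim @* PG = H.
  rewrite -f1E; apply/setP=> y; apply/morphimP/morphimP.
    by case=> u _ Pu ->; have [u1 _ _] := inP u Pu; exists u.1.
  case=> x _; rewrite -{1}fst1 => /morphimP[u _ Pu ->] ->.
  by exists u.
pose D := (PG^`(1))%G.
have sDP : D \subset PG := der_sub 1 PG.
have psiD : psim @* D = H by rewrite -pH -psiP; apply: (morphim_der psim 1 (subxx PG)).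
have kerP2 u : u \in 'ker psim -> u.1 \in Z1 /\ u.2 \in Z2.
  move=> ku; have [u1 u2 fu] := inP _ (dom_ker ku).
  have fu1 : f1 u.1 = 1 by have := mker ku.
  by split; [rewrite -kf1 | rewrite -kf2]; apply/kerP; rewrite // -fu.
have ckP u v : u \in 'ker psim -> v \in PG -> commute u v.
  case/kerP2=> u1 u2 /inP[v1 v2 _]; case: u v u1 u2 v1 v2 => [a b] [c d] /= u1 u2 v1 v2.
  congr (_, _); [exact: (centP (subsetP cZE1 _ u1)) | exact: (centP (subsetP cZE2 _ u2))].
(* [D] already maps onto [H], so [PG] is [D] times the central subgroup ['ker psim], and the two
   have the same derived subgroup. *)
have pD : D^`(1) = D.
  rewrite -(@der1_central_mul _ PG D ('ker psim)%G) //.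
    by apply/subsetP=> u ku; apply/centP=> v Pv; apply: ckP.
  apply/subsetP=> u Pu; have: psim u \in psim @* D by rewrite psiD -psiP mem_morphim.
  case/morphimP=> w _ Dw euw; have Pw := subsetP sDP w Dw.
  rewrite -(mulKVg w u) mem_mulg //; apply/kerP; first by rewrite groupM ?groupV.
  by rewrite morphM ?morphV ?groupV // euw mulVg.
pose Z := ('ker_D psim)%G; exists _, D, Z.
(* [D] projects onto the perfect group [E'], and the preimage of [Z'] in [D] lies in [Z], so [Z'] is
   contained in the image of [Z]. *)
have dvd (eT : finGroupType) (E' Z' : {group eT}) (g : {morphism [set: eT1 * eT2] >-> eT}) :
    g @* PG = E' -> E'^`(1) = E' -> Z' \subset E' ->
    (forall u, u \in PG -> g u \in Z' -> u \in 'ker psim) -> (#|Z'| %| #|Z|)%N.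
  move=> gP' pE' sZE' gZ.
  have gD : g @* D = E' by rewrite -pE' -gP'; apply: (morphim_der g 1 (subsetT PG)).
  apply: dvdn_trans (dvdn_morphim g Z); apply: cardSg.
  apply/subsetP=> z Zz; have: z \in g @* D by rewrite gD (subsetP sZE').
  case/morphimP=> u _ Du defz; apply/morphimP; exists u; rewrite ?inE //=.
  have := gZ u (subsetP sDP u Du); rewrite -defz Zz => /(_ isT).
  by rewrite !inE Du.
split.
- split; last by rewrite -[X in _ \isog X]psiD; apply: first_isog_loc.
  rewrite [X in _ :&: X]pD subsetI subsetIl andbT subsetI subsetIl /=.
  apply/subsetP=> u /setIP[Du ku]; apply/centP=> v Dv.
  exact/ckP/(subsetP sDP).
- apply: (dvd _ _ _ (fst_morphism eT1 eT2) fst1) => // u Pu u1.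
  by apply/kerP => //; apply/(kerP f1) => /=; rewrite ?kf1 // (subsetP sZE1).
apply: (dvd _ _ _ (snd_morphism eT1 eT2) snd2) => // u Pu u2.
have [_ u2E fu] := inP _ Pu; apply/kerP => //=; rewrite /psi fu.
by apply/(kerP f2); rewrite ?kf2.
Qed.

(** A stem kernel of maximal order [m] has order divisible by that of every other one: the kernel of
    a common cover is a multiple of both, and by maximality has order [m]. *)
Lemma stem_kernel_dvd_schur gT (H : {group gT}) eT (E Z : {group eT}) p :
    H^`(1) = H -> stem_extension H E Z -> (p %| #|Z|)%N ->
  schur_order_divisible H p.
Proof.
move=> pH stemE dvp.
pose P n := `[< exists (eT : finGroupType) (E Z : {group eT}),
  stem_extension H E Z /\ #|Z| = n >].
have exP : exists n, P n by exists #|Z|; apply/asboolP; exists eT, E, Z.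
have leP n : P n -> (n <= #|H| ^ (#|H| * #|H|))%N.
  by case/asboolP=> eT' [E' [Z' [st <-]]]; apply: stem_kernel_bound st.
case: (ex_maxnP exP leP) => m /asboolP[eT1 [E1 [Z1 [stem1 card1]]]] maxm.
exists m; split.
  split=> [|eT' E' Z' st]; first by exists eT1, E1, Z1.
  by apply: maxm; apply/asboolP; exists eT', E', Z'.
have [eT' [E' [Z' [st d1 d2]]]] := stem_common_cover pH stem1 stemE.
apply: dvdn_trans dvp (dvdn_trans d2 _).
suff -> : #|Z'| = m by [].
apply/eqP; rewrite eqn_leq maxm /=; last by apply/asboolP; exists eT', E', Z'.
by rewrite -card1 dvdn_leq ?cardG_gt0.
Qed.

End SchurMultiplier.

(** * Splitting central p-subgroups *)

Section CentralSplitting.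

Implicit Types gT : finGroupType.

(** This is [O^p(E)], the smallest normal subgroup with quotient a [p]-group; [p_residual_quotient]
    and [p_residual_min] give this characterisation. *)
Definition p_residual gT (p : nat) (E : {set gT}) := <<[set x in E | p^'.-elt x]>>.
Canonical p_residual_group gT p (E : {set gT}) := [group of p_residual p E].

Lemma p_residual_sub gT (p : nat) (E : {group gT}) : p_residual p E \subset E.
Proof. by rewrite gen_subG; apply/subsetP=> x /setIdP[]. Qed.

Lemma p_residual_norm gT (p : nat) (E Q : {group gT}) :
  Q \subset 'N(E) -> Q \subset 'N(p_residual p E).
Proof.
move=> nEQ; apply: norms_gen; apply/normsP=> g Qg.
apply/setP=> x; rewrite mem_conjg !inE -mem_conjg (normsP nEQ g Qg).
by rewrite p_eltJ.
Qed.

(** Modulo [X] every element agrees with its [p]-part. *)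
Lemma p_residual_quotient gT (p : nat) (E X : {group gT}) : prime p ->
  X <| E -> p_residual p E \subset X -> p.-group (E / X).
Proof.
move=> p_pr /andP[sXE nXE] sRX; apply/pgroupP=> q q_pr q_dvd.
have [y Ey oy] := Cauchy q_pr q_dvd.
case/morphimP: Ey oy => x Nx Ex -> oy.
have pelt : p.-elt (coset X x).
  have -> : coset X x = coset X x.`_p.
    rewrite -[x in LHS](consttC p) morphM ?groupX //=.
    rewrite [coset X x.`_p^']coset_id ?mulg1 // (subsetP sRX) // mem_gen //.
    by rewrite inE groupX // p_elt_constt.
  by rewrite morph_p_elt ?groupX ?p_elt_constt.
by move: pelt; rewrite /p_elt oy pnatE.
Qed.

Lemma p_residual_min gT (p : nat) (E X : {group gT}) :
  X <| E -> p.-group (E / X) -> p_residual p E \subset X.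
Proof.
move=> /andP[sXE nXE] pEX; rewrite gen_subG; apply/subsetP=> x /setIdP[Ex p'x].
have Nx := subsetP nXE x Ex; apply: coset_idr => //.
apply/eqP; rewrite -order_eq1; apply/eqP.
apply: (pnat_1 (pi := p)).
  by apply: mem_p_elt pEX _; apply: mem_quotient.
exact: morph_p_elt p'x.
Qed.

Lemma p_residual_morphim gT (p : nat) (E N : {group gT}) :
  E \subset 'N(N) -> p_residual p E / N \subset p_residual p (E / N).
Proof.
move=> nNE; rewrite quotient_gen; last first.
  by apply/subsetP=> x /setIdP[Ex _]; apply: (subsetP nNE).
rewrite gen_subG; apply/subsetP=> _ /morphimP[x Nx /setIdP[Ex p'x] ->].
by rewrite mem_gen // inE mem_quotient // morph_p_elt.
Qed.

Definition no_p_or_schur gT (p : nat) (S : {group gT}) : Prop :=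
  #|S| <> p /\ (~~ abelian S -> ~ schur_order_divisible S p).

Lemma p_residual_abelian gT (p : nat) (E Z : {group gT}) :
  abelian E -> Z \subset E -> p.-group Z -> Z :&: p_residual p E = 1.
Proof.
move=> abE sZE pZ.
have hall := nilpotent_pcore_Hall p^' (abelian_nil abE).
have sR : p_residual p E \subset 'O_p^'(E).
  rewrite gen_subG; apply/subsetP=> x /setIdP[Ex p'x].
  by rewrite (mem_normal_Hall hall) ?pcore_normal.
apply: coprime_TIg; apply: (pnat_coprime pZ).
exact: pgroupS sR (pcore_pgroup _ _).
Qed.

(** The derived subgroup [D] is perfect and [E = D Z], so [D] is a stem extension of [E / Z] whose
    kernel is the [p]-group [Z :&: D]. The Schur hypothesis makes this kernel trivial. As [E / D] is
    an image of [Z], it is a [p]-group, and [O^p(E)] lies in [D]. *)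
Lemma p_residual_simple_top gT (p : nat) (E Z : {group gT}) :
    prime p -> Z \subset 'Z(E) -> p.-group Z -> simple (E / Z) ->
    ~~ abelian (E / Z) -> ~ schur_order_divisible (E / Z)%G p ->
  Z :&: p_residual p E = 1.
Proof.
move=> p_pr sZZ pZ simQ nabQ nschur.
have /subsetIP[sZE cZE] := sZZ; have nZE := normal_norm (sub_center_normal sZZ).
have pQ : (E / Z)^`(1) = E / Z.
  have [_ /(_ (E / Z)^`(1)%G (der_normal 1 _))[/derG1P ab | //]] := simpleP _ simQ.
  by rewrite ab in nabQ.
pose D := E^`(1)%G.
have sDE : D \subset E := der_sub 1 E.
have sEDZ : E \subset D * Z.
  have nZD : D \subset 'N(Z) := subset_trans sDE nZE.
  rewrite (normC nZD) -quotientSK //.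
  by rewrite /= quotient_der // pQ.
have pD : D^`(1) = D by rewrite -(der1_central_mul cZE sDE sEDZ).
have nZD : D \subset 'N(Z) := subset_trans sDE nZE.
have stem : stem_extension (E / Z)%G D (Z :&: D)%G.
  split; last first.
    have -> : (E / Z)%G :=: D / Z by rewrite /= quotient_der // pQ.
    exact: second_isog.
  rewrite [X in _ :&: X]pD subsetI subsetIr andbT subsetI subsetIr /=.
  by rewrite (subset_trans (subsetIl _ _)) // (subset_trans cZE) // centS.
have ZD1 : Z :&: D = 1.
  apply: card1_trivg; apply/eqP; rewrite -[_ == _]negbK -trivg_card1.
  apply/negP=> ntZD.
  have [_ p_dvd _] := pgroup_pdiv (pgroupS (subsetIl Z D) pZ) ntZD.
  exact: nschur (stem_kernel_dvd_schur pQ stem p_dvd).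
apply/trivgP; rewrite -ZD1 setIS // p_residual_min ?der_normal //.
have -> : E / D = Z / D.
  apply/eqP; rewrite eqEsubset [X in _ && X]quotientS // andbT.
  by rewrite quotientSK ?normal_norm ?der_normal.
exact: quotient_pgroup.
Qed.

(** Induction on [#|E|]. Let [M] be a maximal normal subgroup containing [Z] and [N = O^p(M)].
    Induction gives [Z :&: N = 1], so [N] can be factored out without affecting [Z]. What remains is
    a central [p]-group with simple quotient [E / M]: an abelian group, or the case of
    [p_residual_simple_top]. *)
Lemma central_p_residual gT (p : nat) (Z E : {group gT}) :
    prime p -> Z \subset 'Z(E) -> p.-group Z ->
    (forall X X' : {group gT}, Z \subset X' -> X' <| X -> X <|<| E ->
       simple (X / X') -> no_p_or_schur p (X / X')%G) ->
  Z :&: p_residual p E = 1.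
Proof.
move=> p_pr; move: {2}#|E| (leqnn #|E|) => m; elim: m E => [|m IHm] E.
  by rewrite leqNgt cardG_gt0.
move=> leEm sZZ pZ good.
have /subsetIP[sZE cZE] := sZZ; have nZE := normal_norm (sub_center_normal sZZ).
have [defZ | ltZE] := eqVproper sZE.
  apply/trivgP; apply: subset_trans (subsetIr _ _) _.
  apply: p_residual_min; first exact: normal1.
  by rewrite -defZ quotient_pgroup.
have : (Z \proper E) && (E \subset 'N(Z)) by rewrite ltZE.
case/(@maxgroup_exists _ (fun A => (A \proper E) && (E \subset 'N(A))))=> M maxM sZM.
have nME : M <| E := maxnormal_normal maxM.
have ltME : M \proper E := maxnormal_proper maxM.
have simEM : simple (E / M) by rewrite quotient_simple.
have [sME nME'] := andP nME.
have ZM1 : Z :&: p_residual p M = 1.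
  apply: IHm => //; first by rewrite -ltnS (leq_trans (proper_card ltME)).
    by rewrite subsetI sZM (subset_trans cZE) ?centS.
  by move=> X X' sX' nX' snX; apply: good => //; apply: subnormal_trans snX (normal_subnormal nME).
pose N := p_residual_group p M.
have nNE : E \subset 'N(N) by apply: p_residual_norm.
have sNM : N \subset M := p_residual_sub p M.
have nNM : M \subset 'N(N) := subset_trans sME nNE.
have nZM : M \subset 'N(Z) := subset_trans sME nZE.
(* [M / (N Z)] is a [p]-group; if nontrivial it would have a top factor of order [p], which [good]
   forbids. *)
have defM : N <*> Z = M.
  apply/eqP; apply: contraT => neqM.
  have ltM : (N <*> Z \proper M) && (M \subset 'N(N <*> Z)).
    by rewrite properEneq neqM join_subG sNM sZM normsY.
  have [X' maxX' sX'] :=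
    @maxgroup_exists _ (fun A => (A \proper M) && (M \subset 'N(A))) (N <*> Z)%G ltM.
  have nX'M : X' <| M := maxnormal_normal maxX'.
  have simX' : simple (M / X') by rewrite quotient_simple.
  have [sNX' sZX'] : N \subset X' /\ Z \subset X' by apply/andP; rewrite -join_subG.
  have pMX' : p.-group (M / X') := p_residual_quotient p_pr nX'M sNX'.
  have [/= not_p _] := good M X' sZX' nX'M (normal_subnormal nME) simX'.
  case: not_p; have := simple_sol_prime (pgroup_sol pMX') simX'.
  by move=> q_pr; move: pMX'; rewrite /pgroup pnatE // => /eqP.
suff ZN1 : (Z / N) :&: p_residual p (E / N) = 1.
  apply/trivgP/subsetP=> x /setIP[Zx Rx]; rewrite -ZM1 inE Zx /=.
  have Nx : x \in 'N(N) by rewrite (subsetP nNE) // (subsetP sZE).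
  apply: coset_idr => //; apply/set1P; rewrite -[[set 1]]ZN1 inE mem_quotient //=.
  by rewrite (subsetP (p_residual_morphim p nNE)) // mem_quotient.
have sZN : Z / N \subset 'Z(E / N).
  rewrite subsetI quotientS //=; apply: quotient_cents2r.
  by move/commG1P: cZE => ->; rewrite sub1G.
have isoQ : (E / N) / (Z / N) \isog E / M.
  have -> : Z / N = M / N by rewrite -defM quotientYidl // (subset_trans sZM).
  by apply: third_isog => //; rewrite /normal ?sNM (subset_trans sNM sME).
have pZN : p.-group (Z / N) by apply: quotient_pgroup.
have simQ : simple ((E / N) / (Z / N)) by rewrite (isog_simple isoQ).
have [/= _ nschur] := good E M sZM nME (subnormal_refl E) simEM.
have [abQ | nabQ] := boolP (abelian (E / M)).
  apply: p_residual_abelian => //; last by rewrite quotientS.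
  apply: cyclic_factor_abelian sZN _; rewrite (isog_cyclic isoQ).
  by apply: prime_cyclic; apply: simple_sol_prime simEM; apply: abelian_sol.
apply: p_residual_simple_top => //; first by rewrite (isog_abelian isoQ).
move=> schurQ; apply: nschur => //.
case: schurQ => n [[[eT [F [Y [[sY isoY] cY]]]] maxn] dvdn]; exists n; split=> //; split.
  exists eT, F, Y; split=> //; split=> //; exact: isog_trans isoY isoQ.
move=> eT' F' Y' [sY' isoY']; apply: maxn; split; first exact: sY'.
by apply: isog_trans isoY' _; rewrite isog_sym.
Qed.

End CentralSplitting.

From mathcomp Require Import classical_sets cardinality topology.
Local Open Scope classical_set_scope.

(** * Open normal subgroups of profinite groups *)

Section QuotientGroup.

Variables (G : topGroupType) (L : set G).
Hypothesis nL : Defs.normal_sub L.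
Variable s : seq G.
Hypothesis sP : forall h : G, exists2 x, x \in s & L (x^-1 * h).

Let L1 : L 1 := nL.1.1.
Let LM x y : L x -> L y -> L (x * y) := nL.1.2.1 x y.
Let LV x : L x -> L x^-1 := nL.1.2.2 x.
Let LJ x y : L x -> L (x ^ y). Proof. by apply: nL.2.2. Qed.

Let in_coset (x y : G) := `[< L (y^-1 * x) >].
Let rep (x : G) : G := nth 1 s (find (in_coset x) s).

Let has_rep x : has (in_coset x) s.
Proof. by have [y sy Ly] := sP x; apply/hasP; exists y => //; apply/asboolP. Qed.

Let rep_in x : rep x \in s.
Proof. by rewrite mem_nth // -has_find has_rep. Qed.

Let repP x : L ((rep x)^-1 * x).
Proof. exact/asboolP/(nth_find 1 (has_rep x)). Qed.

Let rep_eq x y : L (x^-1 * y) -> rep x = rep y.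
Proof.
move=> Lxy; rewrite /rep (@eq_find _ _ (in_coset y)) // => z.
apply/asboolP/asboolP=> [Lzx | Lzy].
  by have := LM Lzx Lxy; rewrite -mulgA mulKVg.
by have := LM Lzy (LV Lxy); rewrite invgM invgK -mulgA mulKVg.
Qed.

Let repK x : rep (rep x) = rep x. Proof. exact: rep_eq. Qed.

Let rep_eqE x y : rep x = rep y -> L (x^-1 * y).
Proof.
by move=> exy; have := LM (LV (repP x)) (repP y); rewrite exy invgM invgK -mulgA mulKVg.
Qed.

Let rep_mul x y x' y' : rep x = rep x' -> rep y = rep y' -> rep (x * y) = rep (x' * y').
Proof.
move=> /rep_eqE Lx /rep_eqE Ly; apply: rep_eq.
have -> : (x * y)^-1 * (x' * y') = (x^-1 * x') ^ y * (y^-1 * y').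
  by rewrite conjgE invgM !mulgA mulgK.
exact: LM (LJ _ Lx) Ly.
Qed.

(** The quotient by [L] is carried by canonical representatives: [rep x] is the first entry of [s]
    in the coset of [x], and finiteness comes from [seq_sub s]. *)
Definition coset_type := {x : seq_sub s | rep (val x) == val x}.
HB.instance Definition _ := Finite.on coset_type.

Let pi (x : G) : coset_type := exist _ (SeqSub (rep_in x)) (introT eqP (repK x)).
Let lift (q : coset_type) : G := val (val q).
Let piK q : pi (lift q) = q.
Proof. by case: q => x hx; do 2!apply: val_inj; apply/eqP. Qed.
Let pi_eq x y : rep x = rep y -> pi x = pi y.
Proof. by move=> exy; do 2!apply: val_inj. Qed.
Let lift_pi x : rep (lift (pi x)) = rep x. Proof. exact: repK. Qed.

Let mulq (a b : coset_type) := pi (lift a * lift b).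
Let oneq := pi 1.
Let invq (a : coset_type) := pi (lift a)^-1.
Let mulqA : associative mulq.
Proof.
move=> a b c; apply: pi_eq.
rewrite (rep_mul (erefl (rep (lift a))) (lift_pi (lift b * lift c))) mulgA.
exact: esym (rep_mul (lift_pi (lift a * lift b)) (erefl (rep (lift c)))).
Qed.
Let mul1q : left_id oneq mulq.
Proof.
move=> a; rewrite -[RHS]piK; apply: pi_eq.
by rewrite (rep_mul (lift_pi 1) (erefl (rep (lift a)))) mul1g.
Qed.
Let mulVq : left_inverse oneq invq mulq.
Proof.
move=> a; apply: pi_eq.
by rewrite (rep_mul (lift_pi (lift a)^-1) (erefl (rep (lift a)))) mulVg.
Qed.
HB.instance Definition _ := Finite_isGroup.Build coset_type mulqA mul1q mulVq.

Lemma finite_quotient : exists (gT : finGroupType) (f : G -> gT),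
  [/\ {morph f : x y / x * y}, forall y, exists x, f x = y
    & forall x, f x = 1 <-> L x].
Proof.
exists coset_type, pi; split.
- move=> x y; apply: pi_eq; apply: rep_mul; exact/esym/lift_pi.
- by move=> q; exists (lift q).
move=> x; split=> [/(congr1 lift) | Lx].
  by move=> e; have := @rep_eqE 1 x (esym e); rewrite invg1 mul1g.
by apply: pi_eq; apply/esym/rep_eq; rewrite invg1 mul1g.
Qed.

End QuotientGroup.

(** * Compactness and open subgroups *)

Section ProfiniteBasics.

Variable G : topGroupType.
Hypothesis HG : profinite G.

Let mulC : continuous (fun p : (G * G)%type => p.1 * p.2) := HG.1.
Let invC : continuous (fun x : G => x^-1) := HG.2.1.
Let cG : compact [set: G] := HG.2.2.1.
Let hG : hausdorff_space G := HG.2.2.2.1.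

(** The sets form a base of a proper filter; by compactness it has a cluster point, which lies in
    every closed member. *)
Lemma directed_common_point (V : set (set G)) :
    (exists A, V A) -> (forall A, V A -> closed A) -> (forall A, V A -> A !=set0) ->
    (forall A B, V A -> V B -> exists2 D, V D & D `<=` A `&` B) ->
  exists x, forall A, V A -> A x.
Proof.
move=> V0 Vcl Vne Vdir.
pose F := filter_from V id.
have FF : ProperFilter F.
  apply: filter_from_proper => //; exact: filter_from_filter.
have [x [_ clx]] : [set: G] `&` cluster F !=set0.
  by apply: cG; case: V0 => A VA; exists A.
exists x => A VA; apply: (Vcl A VA) => B Bx.
by apply: clx => //; exists A.
Qed.

Lemma nested_common_point (A : nat -> set G) :
    (forall n, closed (A n)) -> (forall n, A n !=set0) ->
    (forall n, A n.+1 `<=` A n) ->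
  exists x, forall n, A n x.
Proof.
move=> Acl Ane Adec.
have Amono m n : (m <= n)%N -> A n `<=` A m.
  move=> /subnK <-; elim: (n - m)%N => [|k IHk] //.
  by rewrite addSn; apply: subset_trans (Adec _) IHk.
have [] := @directed_common_point [set B | exists n, B = A n].
- by exists (A 0%N), 0%N.
- by move=> _ [n ->].
- by move=> _ [n ->].
- move=> _ _ [m ->] [n ->]; exists (A (maxn m n)); first by exists (maxn m n).
  by move=> x Ax; split; apply: Amono Ax; rewrite ?leq_maxl ?leq_maxr.
by move=> x Ax; exists x => n; apply: Ax; exists n.
Qed.

Lemma mul_continuous (T : topologicalType) (f g : T -> G) :
  continuous f -> continuous g -> continuous (fun x => f x * g x).
Proof.
move=> cf cg x.
apply: (@continuous_comp _ _ _ (fun y => (f y, g y)) (fun p => p.1 * p.2)).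
  by apply: cvg_pair; [apply: cf | apply: cg].
exact: mulC.
Qed.

Lemma lmul_continuous (g : G) : continuous (fun x : G => g * x).
Proof. by apply: mul_continuous => x; [apply: cvg_cst | apply: cvg_id]. Qed.

Lemma conj_continuous (g : G) : continuous (fun x : G => x ^ g).
Proof.
under eq_fun do rewrite conjgE.
apply: mul_continuous; first by move=> x; apply: cvg_cst.
by apply: mul_continuous => x; [apply: cvg_id | apply: cvg_cst].
Qed.

Lemma comm_continuous (g : G) : continuous (fun x : G => [~ x, g]).
Proof.
rewrite /commg; apply: mul_continuous; first exact: invC.
exact: conj_continuous.
Qed.

Lemma open_lcoset (H : set G) g : open H -> open [set x | H (g^-1 * x)].
Proof. by move=> oH; apply: (continuousP _).1 oH; apply: lmul_continuous. Qed.

Lemma closed_lcoset (H : set G) g : closed H -> closed [set x | H (g^-1 * x)].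
Proof. by move=> oH; apply: (continuous_closedP _).1 oH; apply: lmul_continuous. Qed.

Lemma subgroup_open_of_sub (K H : set G) :
  open K -> K 1 -> is_subgroup H -> K `<=` H -> open H.
Proof.
move=> oK K1 [H1 [HM HV]] sKH.
have -> : H = \bigcup_(g in H) [set x | K (g^-1 * x)].
  apply/seteqP; split=> x; first by move=> Hx; exists x => //=; rewrite mulVg.
  by case=> g Hg /= /sKH Hgx; rewrite -(mulKVg g x); apply: (HM).
by apply: bigcup_open => g _; apply: open_lcoset.
Qed.

Lemma open_subgroup_closed (H : set G) : is_subgroup H -> open H -> closed H.
Proof.
move=> [H1 [HM HV]] oH; rewrite -openC.
have -> : ~` H = \bigcup_(g in ~` H) [set x | H (g^-1 * x)].
  apply/seteqP; split=> x; first by move=> Hx; exists x => //=; rewrite mulVg.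
  case=> g nHg /= Hgx Hx; apply: nHg; rewrite -(invgK g); apply: (HV).
  by rewrite -(mulgK x g^-1); apply: (HM) => //; apply: (HV).
by apply: bigcup_open => g _; apply: open_lcoset.
Qed.

(** If no finite list of cosets covered [G], the closed complements of finite unions of cosets would
    share a point, yet that point lies in its own coset. *)
Lemma open_finite_index (H : set G) :
  is_subgroup H -> open H -> finite_index_in H [set: G].
Proof.
move=> sH oH; apply: contrapT => nfin.
pose B (s : seq G) := [set x : G | forall y, y \in s -> ~ H (y^-1 * x)].
have [] := @directed_common_point [set A | exists s, A = B s].
- by exists (B [::]), [::].
- move=> _ [s ->].
  have -> : B s = \bigcap_(y in [set y | y \in s]) ~` [set x | H (y^-1 * x)] by [].
  by apply: closed_bigI => y _; rewrite closedC; apply: open_lcoset.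
- move=> _ [s ->]; apply: contrapT => Bs0; apply: nfin; exists s => h _.
  apply: contrapT => nh; apply: Bs0; exists h => y sy Hy; apply: nh; by exists y.
- move=> _ _ [s ->] [t ->]; exists (B (s ++ t)); first by exists (s ++ t).
  by move=> x Bx; split=> y sy; apply: Bx; rewrite mem_cat sy ?orbT.
move=> x Bx; have Bxx : B [:: x] x by apply: Bx; exists [:: x].
by apply: (Bxx x); [rewrite mem_seq1 | rewrite mulVg; exact: sH.1].
Qed.

(** [H] is what remains after removing the finitely many closed cosets of the entries of [s] outside
    [H]. *)
Lemma closed_finite_index_open (H : set G) :
  is_subgroup H -> closed H -> finite_index_in H [set: G] -> open H.
Proof.
move=> [H1 [HM HV]] cH [s sP].
have openB (t : seq G) : open [set x | forall y, y \in t -> ~ H y -> ~ H (y^-1 * x)].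
  elim: t => [|y t IHt].
    rewrite (_ : mkset _ = setT); first exact: openT.
    by apply/seteqP; split.
  have [Hy|nHy] := pselect (H y).
    rewrite (_ : mkset _ = [set x | forall y, y \in t -> ~ H y -> ~ H (y^-1 * x)]) //.
    apply/seteqP; split=> x Bx z; first by move=> tz; apply: Bx; rewrite in_cons tz orbT.
    by rewrite in_cons => /predU1P[-> //|]; apply: Bx.
  rewrite (_ : mkset _ = [set x | forall y, y \in t -> ~ H y -> ~ H (y^-1 * x)]
                         `&` ~` [set x | H (y^-1 * x)]).
    by apply: openI => //; rewrite openC; apply: closed_lcoset.
  apply/seteqP; split=> x; first move=> Bx; last move=> [Bx nH] z.
    by split=> [z tz|]; apply: Bx; rewrite // in_cons ?eqxx ?tz ?orbT.
  by rewrite in_cons => /predU1P[-> //|]; apply: Bx.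
have -> // : H = [set x | forall y, y \in s -> ~ H y -> ~ H (y^-1 * x)].
apply/seteqP; split=> x.
  move=> Hx y sy nHy Hyx; apply: nHy; rewrite -(invgK y); apply: (HV).
  by rewrite -(mulgK x y^-1); apply: (HM) => //; apply: (HV).
move=> Bx; have [y sy Hyx] := sP x I.
have Hy : H y by apply: contrapT => nHy; apply: (Bx y sy nHy Hyx).
by rewrite -(mulKVg y x); apply: (HM).
Qed.

Lemma open_normal_core (H : set G) : is_subgroup H -> open H ->
  exists N, [/\ Defs.normal_sub N, open N & N `<=` H].
Proof.
move=> sH oH; have [s sP] := open_finite_index sH oH; have [H1 [HM HV]] := sH.
pose N := [set g : G | forall x, H (g ^ x)].
have HJ k g : H k -> H g -> H (g ^ k).
  by move=> Hk Hg; rewrite conjgE; apply: (HM); [apply: (HV) | apply: (HM)].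
have nN : Defs.normal_sub N.
  split; [split; [|split] | split].
  - by move=> x; rewrite conj1g.
  - by move=> x y Nx Ny z; rewrite conjMg; apply: (HM).
  - by move=> x Nx z; rewrite conjVg; apply: (HV).
  - by [].
  - by move=> k h _ Nh x; rewrite -conjgM.
exists N; split=> //; last by move=> g /(_ 1); rewrite conjg1.
(* The conditions for [x] in one left coset of [H] are equivalent, so finitely many open conditions
   suffice. *)
have -> : N = [set g : G | forall x, x \in s -> H (g ^ x)].
  apply/seteqP; split=> g Ng x //.
  have [y sy Hyx] := sP x I; rewrite -(mulKVg y x) conjgM; apply: (HJ) => //.
  exact: Ng.
elim: s {sP} => [|x s IHs].
  rewrite (_ : mkset _ = setT); first exact: openT.
  by apply/seteqP; split.
rewrite (_ : mkset _ = [set g : G | forall x, x \in s -> H (g ^ x)] `&` [set g | H (g ^ x)]).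
  by apply: openI => //; apply: (continuousP _).1 oH; apply: conj_continuous.
apply/seteqP; split=> g; first move=> Bx; last move=> [Bx nH] z.
  by split=> [z tz|]; apply: Bx; rewrite // in_cons ?eqxx ?tz ?orbT.
by rewrite in_cons => /predU1P[-> //|]; apply: Bx.
Qed.

Lemma closed_trivial : closed (@trivial_set G).
Proof. by apply: (@accessible_closed_set1 G); apply: hausdorff_accessible. Qed.

Lemma open_normal_quotient (L : set G) : Defs.normal_sub L -> open L ->
  exists (gT : finGroupType) (f : G -> gT),
  [/\ {morph f : x y / x * y}, forall y, exists x, f x = y
    & forall x, f x = 1 <-> L x].
Proof.
move=> nL oL; have [s sP] := open_finite_index nL.1 oL.
by apply: (@finite_quotient G L nL s) => h; apply: sP.
Qed.

Lemma subgroupI (H K : set G) : is_subgroup H -> is_subgroup K -> is_subgroup (H `&` K).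
Proof.
move=> [H1 [HM HV]] [K1 [KM KV]]; split=> //; split=> [x y [? ?] [? ?] | x [? ?]].
  by split; [apply: (HM) | apply: (KM)].
by split; [apply: (HV) | apply: (KV)].
Qed.

Lemma normal_subI (H K : set G) :
  Defs.normal_sub H -> Defs.normal_sub K -> Defs.normal_sub (H `&` K).
Proof.
move=> [sH [_ nH]] [sK [_ nK]]; split; first exact: subgroupI.
by split=> // k h _ [Hh Kh]; split; [apply: (nH) | apply: (nK)].
Qed.

End ProfiniteBasics.

(** * Obliquity *)

Section Obliquity.

Variable G : topGroupType.
Hypothesis HG : profinite G.
Implicit Types (H K M N O R V : set G).

Definition open_normal N : Prop := Defs.normal_sub N /\ open N.

Lemma open_normalI N N' : open_normal N -> open_normal N' -> open_normal (N `&` N').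
Proof. by move=> [nN oN] [nN' oN']; split; [apply: normal_subI | apply: openI]. Qed.

Lemma open_normalT : open_normal [set: G].
Proof. by split; [split; [|split] | exact: openT]. Qed.

Lemma open_normal_closed N : open_normal N -> closed N.
Proof. by move=> [nN oN]; apply: (open_subgroup_closed HG) nN.1 oN. Qed.

Lemma open_normal_bigcap (T : finType) (V : T -> set G) :
  (forall t, open_normal (V t)) -> open_normal [set x | forall t, V t x].
Proof.
move=> nV.
suff nVs (s : seq T) : open_normal [set x | forall t, t \in s -> V t x].
  rewrite (_ : mkset _ = [set x | forall t, t \in enum T -> V t x]) //.
  apply/seteqP; split=> x Vx t //; exact/Vx/mem_enum.
elim: s => [|t s IHs].
  rewrite (_ : mkset _ = setT); first exact: open_normalT.
  by apply/seteqP; split.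
rewrite (_ : mkset _ = V t `&` [set x | forall t, t \in s -> V t x]).
  exact: open_normalI.
apply/seteqP; split=> x.
  by move=> Vx; split=> [|u su]; apply: Vx; rewrite in_cons ?eqxx ?su ?orbT.
by move=> [Vt Vs] u; rewrite in_cons => /predU1P[-> //|]; apply: Vs.
Qed.

(** Elements of [M n] outside [M n.+1], for different [n], lie in different cosets of [N]. *)
Lemma subgroup_descent_stops N (M : nat -> set G) :
    finite_index_in N [set: G] -> (forall n, is_subgroup (M n)) ->
    (forall n, N `<=` M n) -> (forall n, M n.+1 `<=` M n) ->
  exists n, M n `<=` M n.+1.
Proof.
move=> [s sP] sM sNM decM; apply: contrapT => nstop.
have /choice[x xP] n : exists x, M n x /\ ~ M n.+1 x.
  apply: contrapT => nx; apply: nstop; exists n => y My.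
  by apply: contrapT => nMy; apply: nx; exists y.
have /choice[r rP] n : exists r, r \in s /\ N (r^-1 * x n).
  by have [r sr Nr] := sP (x n) I; exists r.
have Mmono m n : (m <= n)%N -> M n `<=` M m.
  move=> /subnK <-; elim: (n - m)%N => [|k IHk] //.
  by rewrite addSn; apply: subset_trans (decM _) IHk.
have r_inj : injective r.
  suff lt_r m n : (m < n)%N -> r m <> r n.
    by move=> m n rmn; case: (ltngtP m n) => // lt_mn; case: (lt_r _ _ lt_mn).
  move=> lt_mn rmn; have [M1 [MM MV]] := sM m.+1.
  case: (xP m) => _; apply.
  rewrite -(mulKVg (r m) (x m)); apply: (MM); last exact/sNM/(rP m).2.
  have -> : r m = x n * ((r n)^-1 * x n)^-1 by rewrite invgM invgK mulKVg.
  apply: (MM); last exact/MV/sNM/(rP n).2.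
  exact: Mmono lt_mn _ (xP n).1.
have ur : uniq (map r (iota 0 (size s).+1)) by rewrite (map_inj_uniq r_inj) iota_uniq.
have /(uniq_leq_size ur) : {subset map r (iota 0 (size s).+1) <= s}.
  by move=> _ /mapP[n _ ->]; case: (rP n).
by rewrite size_map size_iota ltnn.
Qed.

Section Normalised.

Variable R : set G.

Definition closed_normalised H : Prop :=
  [/\ is_subgroup H, closed H & normalised_by R H].

Lemma closed_normalised_bigcap (X : set (set G)) :
  (forall H, X H -> closed_normalised H) ->
  closed_normalised [set x | forall H, X H -> H x].
Proof.
move=> cX; split; first split; first by move=> H /cX[[]].
- split=> [x y Hx Hy H XH | x Hx H XH]; have [[_ [HM HV]] _ _] := cX H XH.
    by apply: HM; [apply: Hx | apply: Hy].
  by apply: HV; apply: Hx.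
- have -> : [set x | forall H, X H -> H x] = \bigcap_(H in X) H by [].
  by apply: closed_bigI => H /cX[].
move=> k h Rk Hh H XH; have [_ _ nH] := cX H XH; apply: nH => //; exact: Hh.
Qed.

Lemma closed_normalisedI H K :
  closed_normalised H -> closed_normalised K -> closed_normalised (H `&` K).
Proof.
move=> [sH cH nH] [sK cK nK]; split; [exact: subgroupI | exact: closedI |].
by move=> k h Rk [Hh Kh]; split; [apply: nH | apply: nK].
Qed.

(** Supplied by [just_infinite_open] with [R] the whole group, and by [hereditarily_open] with [R]
    open and normal. *)
Hypothesis open_normalised :
  forall H, closed_normalised H -> H <> @trivial_set G -> open H.

Variable O : set G.
Hypotheses (sO : is_subgroup O) (oO : open O).

Lemma closed_normalised_open H : closed_normalised H -> ~ H `<=` O -> open H.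
Proof.
by move=> cH nHO; apply: open_normalised => // H1; apply: nHO; rewrite H1 => _ ->; apply: sO.1.
Qed.

(** Otherwise there is a strictly descending sequence in [X]. By compactness of the sets [M n] minus
    [O], its intersection is not inside [O], hence is open and of finite index, and the sequence
    stalls. *)
Lemma closed_normalised_min (X : set (set G)) :
    (exists H, X H) -> (forall H, X H -> closed_normalised H /\ ~ H `<=` O) ->
  exists2 M, X M & forall N, X N -> N `<=` M -> N = M.
Proof.
move=> [H0 XH0] XP; apply: contrapT => nmin.
have step (u : {H | X H}) : exists v : {H | X H}, sval v `<=` sval u /\ ~ (sval u `<=` sval v).
  case: u => M XM /=; apply: contrapT => nv; apply: nmin; exists M => // N XN sNM.
  apply/seteqP; split=> //; apply: contrapT => nMN; apply: nv.
  by exists (exist _ N XN).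
have /choice[next nextP] := step.
pose M n := sval (iter n next (exist _ H0 XH0)).
have XM n : X (M n) := svalP (iter n next (exist _ H0 XH0)).
have [x xP] : exists x, forall n, (M n `&` ~` O) x.
  apply: (nested_common_point HG) => n.
  - have [[_ cM _] _] := XP _ (XM n); apply: closedI => //; exact: open_closedC.
  - have [_ nMO] := XP _ (XM n); apply: contrapT => Mn0; apply: nMO => y My.
    by apply: contrapT => nOy; apply: Mn0; exists y.
  - by move=> y [My nOy]; split=> //; apply: (nextP _).1.
pose N := [set y | forall H, [set H | exists n, H = M n] H -> H y].
have cN : closed_normalised N.
  by apply: closed_normalised_bigcap => _ [n ->]; case: (XP _ (XM n)).
have oN : open N.
  apply: closed_normalised_open => // sNO; have [_ nOx] := xP 0%N; apply/nOx/sNO.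
  by move=> _ [n ->]; case: (xP n).
have [sN _ _] := cN.
have [||||n] := @subgroup_descent_stops N M; first exact: (open_finite_index HG).
- by move=> n; case: (XP _ (XM n)) => [[]].
- by move=> n y Ny; apply: Ny; exists n.
- by move=> n; apply: (nextP _).1.
exact: (nextP _).2.
Qed.

Definition minimal_outside M : Prop :=
  [/\ closed_normalised M, ~ M `<=` O
    & forall N, closed_normalised N -> ~ N `<=` O -> N `<=` M -> N = M].

Lemma minimal_outside_exists H : closed_normalised H -> ~ H `<=` O ->
  exists2 M, minimal_outside M & M `<=` H.
Proof.
move=> cH nHO.
have [||M [[cM nMO] sMH] minM] := @closed_normalised_min
    [set K | (closed_normalised K /\ ~ K `<=` O) /\ K `<=` H].
- by exists H; split=> // x.
- by move=> K [].
exists M => //; split=> // N cN nNO sNM; apply: minM => //.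
by split=> //; apply: subset_trans sMH.
Qed.

Definition uniformly_open (X : set (set G)) : Prop :=
  exists2 V, open_normal V & forall M, X M -> V `<=` M.

Let join (X : set (set G)) : set G :=
  [set x | forall H, [set H | closed_normalised H /\ forall M, X M -> M `<=` H] H -> H x].

(* Generalised obliquity: an infinite family of minimal members outside [O]    *)
(* whose join is least possible would have all its members congruent modulo    *)
(* a small open normal subgroup.                                               *)
Lemma obliquity : exists2 V, open_normal V &
  forall H, closed_normalised H -> H `<=` O \/ V `<=` H.
Proof.
suff [V nV VP] : uniformly_open minimal_outside.
  exists V => // H cH; have [HO|nHO] := pselect (H `<=` O); [by left | right].
  have [M minM sMH] := minimal_outside_exists cH nHO.
  exact: subset_trans (VP M minM) sMH.
apply: contrapT => nbdd.
have cjoin X : closed_normalised (join X) by apply: closed_normalised_bigcap => H [].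
have sub_join X M : X M -> M `<=` join X by move=> XM x Mx H [_ sXH]; apply: (sXH M XM x Mx).
pose small (S : set (set G)) := S `<=` minimal_outside /\ ~ uniformly_open S.
have ne_small S : ~ uniformly_open S -> exists M, S M.
  move=> nS; apply: contrapT => S0; apply: nS; exists setT; first exact: open_normalT.
  by move=> M SM; case: S0; exists M.
have [||_ [S [[sSmin nS] ->]] minS] := @closed_normalised_min
    [set J | exists S, small S /\ J = join S].
- by exists (join minimal_outside), minimal_outside; split=> //; split=> // M.
- move=> _ [S [[sSm nS] ->]]; split=> // sJO.
  have [M SM] := ne_small _ nS; have [_ nMO _] := sSm M SM.
  by apply: nMO => x /(sub_join S M SM); apply: sJO.
have [M SM] := ne_small _ nS; have [cM nMO minM] := sSmin M SM; have [sM _ _] := cM.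
have oM := closed_normalised_open cM nMO.
have [V' [nV' oV' sV']] := open_normal_core HG (subgroupI sM sO) (openI oM oO).
have [gT [f [fM fsurj fker]]] := open_normal_quotient HG nV' oV'.
pose im (A : set G) : {set gT} := [set y : gT | `[< exists2 x, A x & f x = y >]]%SET.
pose SQ (Q : {set gT}) := [set A | S A /\ im A = Q].
(* Sort [S] by the images of its members modulo [V'], finitely many in number. If each class were
   uniformly open, so would [S] be. By minimality the class found has the same join as [S]. *)
have [Q nQ] : exists Q, ~ uniformly_open (SQ Q).
  apply: contrapT => allQ; apply: nS.
  have /choice[VQ VQP] (Q : {set gT}) :
      exists V, open_normal V /\ forall A, SQ Q A -> V `<=` A.
    have [[V nV VP]|nQ] := pselect (uniformly_open (SQ Q)); first by exists V.
    by case: allQ; exists Q.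
  exists [set x | forall Q, VQ Q x].
    by apply: open_normal_bigcap => Q; case: (VQP Q).
  by move=> A SA x Vx; apply: ((VQP (im A)).2 A).
have joinQ : join (SQ Q) = join S.
  apply: minS; first by exists (SQ Q); split=> //; split=> // A [/sSmin].
  move=> x Jx H [cH SH]; apply: Jx; split=> // A [SA _]; exact: SH.
have [M' [SM' imM'] neqM] : exists2 M', SQ Q M' & M' <> M.
  apply: contrapT => allM; apply: nQ.
  have [V [nV oV sVM]] := open_normal_core HG sM oM.
  exists V => // A SA; suff -> : A = M by [].
  by apply: contrapT => neq; apply: allM; exists A.
have [cM' nM'O minM'] := sSmin M' SM'.
have f1 : f 1 = 1 by apply/fker/nV'.1.1.
have fV x : f x^-1 = (f x)^-1.
  by apply/eqP; rewrite -(inj_eq (mulgI (f x))) -fM !mulgV f1.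
(* [M' V'] is a closed normalised subgroup containing every member of the class, hence their join,
   hence [M]. *)
have sMQ m : M m -> exists2 m', M' m' & f m' = f m.
  move=> Mm; have: join S m by apply: sub_join Mm.
  rewrite -joinQ => /(_ [set x | exists2 m', M' m' & f m' = f x]); apply; split; last first.
    move=> A [_ imA] x Ax; have: f x \in im A by rewrite finset.inE; apply/asboolP; exists x.
    by rewrite imA -imM' finset.inE => /asboolP[m' M'm' fm']; exists m'.
  have [[M'1 [M'M M'V]] _ nM'] := cM'.
  have sQ : is_subgroup [set x | exists2 m', M' m' & f m' = f x].
    split; first by exists 1.
    split=> [x y [a Ma ax] [b Mb bx] | x [a Ma ax]].
      by exists (a * b); [apply: M'M | rewrite !fM ax bx].
    by exists a^-1; [apply: M'V | rewrite !fV ax].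
  split=> //.
    apply: (open_subgroup_closed HG) => //.
    apply: (subgroup_open_of_sub HG oV') => //; first exact: nV'.1.1.
    by move=> x Vx; exists 1; rewrite // f1; apply/esym/fker.
  move=> k h Rk [a Ma ah]; exists (a ^ k); first exact: nM'.
  by rewrite !conjgE !fM ah.
apply: nMO => m Mm; have [m' M'm' fm'] := sMQ m Mm.
have [MMV Om] : (M `&` O) (m'^-1 * m) by apply/sV'/fker; rewrite fM fV fm' mulVg.
have Mm' : M m'.
  rewrite -(invgK m'); apply: sM.2.2.
  by rewrite -(mulgK m m'^-1); apply: sM.2.1 => //; apply: sM.2.2.
(* Here [m'] is in both [M] and [M'], and [m'^-1 * m] is in [O]. If [M] and [M'] meet inside [O],
   then [m] is in [O]; if not, minimality identifies each of them with the intersection. *)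
have [sI|nI] := pselect (M `&` M' `<=` O).
  by rewrite -(mulKVg m' m); apply: sO.2.1 => //; apply: sI.
have cI := closed_normalisedI cM cM'.
case: neqM; rewrite -(minM _ cI nI (@subIsetl _ _ _)).
by rewrite -[LHS](minM' _ cI nI (@subIsetr _ _ _)).
Qed.

End Normalised.

End Obliquity.

(** * Finite images and chief factors *)

Section FiniteImages.

Variable G : topGroupType.
Hypothesis HG : profinite G.

(** Continuous finite quotients are maps rather than subgroups, so that further quotients arise by
    composing with [coset]. *)
Definition finite_image (gT : finGroupType) (f : G -> gT) : Prop :=
  [/\ {morph f : x y / x * y}, forall y, exists x, f x = y
    & open [set x | f x = 1]].

(** For a subgroup [A] this is the plain image ([mem_imG]); generation makes it a group for
    arbitrary [A]. *)
Definition imG (gT : finGroupType) (f : G -> gT) (A : set G) : {group gT} :=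
  <<[set y : gT | `[< exists2 x, A x & f x = y >]]%SET>>%G.

Lemma open_normal_finite_image (L : set G) : open_normal L ->
  exists (gT : finGroupType) (f : G -> gT),
    finite_image f /\ forall x, f x = 1 <-> L x.
Proof.
move=> [nL oL]; have [gT [f [fM fs fk]]] := open_normal_quotient HG nL oL.
exists gT, f; split=> //; split=> //.
by rewrite (_ : mkset _ = L) //; apply/seteqP; split=> x /fk.
Qed.

Section OneImage.

Variables (gT : finGroupType) (f : G -> gT).
Hypothesis fi : finite_image f.
Let fM : {morph f : x y / x * y}. Proof. by case: fi. Qed.

Lemma finite_image1 : f 1 = 1.
Proof. by apply: (mulgI (f 1)); rewrite -fM !mulg1. Qed.

Lemma finite_imageV x : f x^-1 = (f x)^-1.
Proof. by apply: (mulgI (f x)); rewrite -fM !mulgV finite_image1. Qed.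

Lemma finite_imageJ x y : f (x ^ y) = f x ^ f y.
Proof. by rewrite !conjgE !fM finite_imageV. Qed.

Lemma finite_imageR x y : f [~ x, y] = [~ f x, f y].
Proof. by rewrite !commgEl fM finite_imageV finite_imageJ. Qed.

Lemma finite_imageX x n : f (x ^+ n) = f x ^+ n.
Proof. by elim: n => [|n IHn]; rewrite ?finite_image1 // !expgS fM IHn. Qed.

Lemma mem_imG A y : is_subgroup A -> y \in imG f A <-> exists2 x, A x & f x = y.
Proof.
move=> [A1 [AM AV]].
have gA : group_set [set y : gT | `[< exists2 x, A x & f x = y >]]%SET.
  apply/group_setP; split.
    by rewrite finset.inE; apply/asboolP; exists 1; rewrite ?finite_image1.
  move=> a b; rewrite !finset.inE => /asboolP[x Ax <-] /asboolP[x' Ax' <-].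
  by apply/asboolP; exists (x * x'); [apply: AM | rewrite fM].
rewrite /imG /= gen_set_id // finset.inE; split; by [move/asboolP | move=> ?; apply/asboolP].
Qed.

Lemma imG_in A x : is_subgroup A -> A x -> f x \in imG f A.
Proof. by move=> sA Ax; apply/mem_imG => //; exists x. Qed.

Lemma imG_full A : is_subgroup A -> (forall x, f x = 1 -> A x) ->
  forall x, f x \in imG f A -> A x.
Proof.
move=> sA kA x /(mem_imG _ sA)[a Aa fa]; rewrite -(mulKVg a x); apply: sA.2.1 => //.
by apply: kA; rewrite fM finite_imageV fa mulVg.
Qed.

Lemma imG_normal N K : is_subgroup K -> normal_in N K -> imG f N <| imG f K.
Proof.
move=> sK [sN [sNK nNK]]; apply/andP; split.
  by apply/fintype.subsetP=> y /(mem_imG _ sN)[x Nx <-]; apply: imG_in => //; apply: sNK.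
apply/fintype.subsetP=> k /(mem_imG _ sK)[g Kg <-]; rewrite finset.inE.
apply/fintype.subsetP=> _ /imsetP[y /(mem_imG _ sN)[x Nx <-] ->].
by rewrite -finite_imageJ; apply: imG_in => //; apply: nNK.
Qed.

Lemma subgroupT : is_subgroup [set: G]. Proof. by []. Qed.

Lemma imGT : imG f [set: G] :=: [set: gT]%SET.
Proof.
apply/finset.setP=> y; rewrite finset.inE; apply/mem_imG => //.
by have [_ fs _] := fi; have [x <-] := fs y; exists x.
Qed.

Lemma imG_normalT N : Defs.normal_sub N -> imG f N <| [set: gT]%SET.
Proof. by move=> nN; rewrite -imGT; apply: imG_normal. Qed.

Lemma preim_open_normal (A : {group gT}) :
  A <| [set: gT]%SET -> open_normal [set x | f x \in A].
Proof.
move=> /andP[_ nA].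
have sA : is_subgroup [set x | f x \in A].
  split; first by rewrite /= finite_image1 group1.
  by split=> [x y|x] /=; rewrite ?fM ?finite_imageV ?groupV; [apply: groupM |].
split.
  split=> //; split=> // k h _ /=; rewrite finite_imageJ memJ_norm //.
  by rewrite (fintype.subsetP nA) ?finset.inE.
have [_ _ oK] := fi; apply: (subgroup_open_of_sub HG oK) => //=; first exact: finite_image1.
by move=> x /= ->; apply: group1.
Qed.

Lemma coset_finite_image (L : {group gT}) :
  L <| [set: gT]%SET -> finite_image (coset L \o f).
Proof.
move=> nL; have nLx x : x \in 'N(L).
  by rewrite (fintype.subsetP (normal_norm nL)) ?finset.inE.
split.
- by move=> x y /=; rewrite fM morphM.
- move=> y; have [g _ ->] := cosetP y.
  by have [_ fs _] := fi; have [x <-] := fs g; exists x.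
have [_ oL] := preim_open_normal nL; rewrite (_ : mkset _ = [set x | f x \in L]) //.
by apply/seteqP; split=> x /=; [apply: coset_idr | move=> Lx; rewrite coset_id].
Qed.

End OneImage.

(** Compares a map from [quot_isog], multiplicative only on [Y], with a finite image having the same
    kernel on [Y]. *)
Lemma isog_same_kernel (Y : set G) (aT bT : finGroupType) (f : G -> aT) (g : G -> bT)
    (A : {group aT}) (B : {group bT}) : is_subgroup Y ->
    (forall x y, Y x -> Y y -> f (x * y) = f x * f y) ->
    (forall a, a \in A <-> exists2 x, Y x & f x = a) ->
    (forall x y, Y x -> Y y -> g (x * y) = g x * g y) ->
    (forall b, b \in B <-> exists2 x, Y x & g x = b) ->
    (forall x, Y x -> (f x = 1 <-> g x = 1)) ->
  A \isog B.
Proof.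
move=> [Y1 [YM YV]] fM fA gM gB fg.
have f1 : f 1 = 1 by apply: (mulgI (f 1)); rewrite -fM // !mulg1.
have g1 : g 1 = 1 by apply: (mulgI (g 1)); rewrite -gM // !mulg1.
have fV x : Y x -> f x^-1 = (f x)^-1.
  by move=> Yx; apply: (mulgI (f x)); rewrite -fM ?mulgV //; apply: YV.
have gV x : Y x -> g x^-1 = (g x)^-1.
  by move=> Yx; apply: (mulgI (g x)); rewrite -gM ?mulgV //; apply: YV.
have fgE x y : Y x -> Y y -> f x = f y <-> g x = g y.
  move=> Yx Yy; have Yxy : Y (x^-1 * y) by apply: YM => //; apply: YV.
  have [fg1 gf1] := fg _ Yxy.
  split=> exy.
    have: g (x^-1 * y) = 1 by apply: fg1; rewrite fM ?fV // ?exy ?mulVg //; exact: YV.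
    by rewrite gM ?gV //; [move/(congr1 (mulg (g x))); rewrite mulKVg mulg1 | exact: YV].
  have: f (x^-1 * y) = 1 by apply: gf1; rewrite gM ?gV // ?exy ?mulVg //; exact: YV.
  by rewrite fM ?fV //; [move/(congr1 (mulg (f x))); rewrite mulKVg mulg1 | exact: YV].
have /choice[s sP] (a : aT) : exists x, a \in A -> Y x /\ f x = a.
  by case: (pselect (a \in A)) => [/fA[x Yx fx]|nA]; [exists x | exists 1].
pose h a := g (s a).
have hM : {in A &, {morph h : x y / x * y}}.
  move=> a b Aa Ab; have [Ya fa] := sP a Aa; have [Yb fb] := sP b Ab.
  have [Yab fab] := sP _ (groupM Aa Ab).
  by rewrite /h -gM //; apply/fgE; rewrite ?fM ?fa ?fb //; apply: YM.
apply/isogP; exists (Morphism hM).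
  apply/injmP=> a b Aa Ab /= hab; have [Ya fa] := sP a Aa; have [Yb fb] := sP b Ab.
  by rewrite -fa -fb; apply/fgE.
apply/finset.setP=> b; apply/morphimP/idP.
  by case=> a _ Aa ->; apply/gB; have [Ya fa] := sP a Aa; exists (s a).
case/gB=> x Yx gx; have Afx : f x \in A by apply/fA; exists x.
have [Yfx ffx] := sP _ Afx.
by exists (f x) => //=; rewrite /h -gx; apply/esym/fgE.
Qed.

End FiniteImages.

(** * Chief factors in the class inside every open normal subgroup *)

Section ClassChiefFactors.

Variable G : topGroupType.
Hypothesis HG : profinite G.
Variable C : group_class.
Hypothesis HC : forall (gT : finGroupType) (T : {group gT}), C T -> simple T.

Definition class_power (gT : finGroupType) (F : {group gT}) : Prop :=
  exists (cT : finGroupType) (T : {group cT}), C T /\ direct_power F T.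

Definition class_factors_everywhere : Prop := forall W : set G, open_normal W ->
  exists (gT : finGroupType) (f : G -> gT) (F : {group gT}),
    [/\ finite_image f, minnormal F [set: gT]%SET, class_power F
      & forall x, f x \in F -> W x].

Lemma chief_factor_image (gT : finGroupType) (f : G -> gT) (K L : {group gT}) :
    finite_image f -> chief_factor [set: gT]%SET L K ->
  [/\ finite_image (coset L \o f), minnormal (K / L) [set: coset_of L]%SET
    & forall x, (coset L \o f) x \in K / L -> f x \in K].
Proof.
move=> fi chKL; have /andP[maxL nK] := chKL.
have /andP[ltLK nLT] := maxgroupp maxL.
have nL : L <| [set: gT]%SET by rewrite /normal finset.subsetT.
split; first exact: coset_finite_image.
  by have := chief_factor_minnormal chKL; rewrite quotientT.
move=> x /= /morphimP[y Ny Ky /(congr1 (fun z => (coset L y)^-1 * z))].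
have Nx : f x \in 'N(L) by rewrite (fintype.subsetP nLT) ?finset.inE.
rewrite mulVg -morphV // -morphM ?groupV // => /coset_idr.
rewrite groupM ?groupV // => /(_ isT) Lyx.
by rewrite -(mulKVg y (f x)) groupM // (fintype.subsetP (proper_sub ltLK)).
Qed.

(** If the factor [Y i.+1 / Y i] is not visible in [W], the image of [Y i] in [G / W] grows strictly
    at [i]. This happens at most [#|wT|] times, so a series with more factors in the class has one
    visible in [W], which [chief_factor_of_section] turns into a chief factor. *)
Lemma class_chief_below : cond_starstar G C -> class_factors_everywhere.
Proof.
move=> [star _] W nW.
have [wT [w [wi wker]]] := open_normal_finite_image HG nW.
have [N [nN [oN [m [Y [Y0 [Ym [sY [idx [uidx [szidx idxP]]]]]]]]]]] := star #|wT|.+1.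
have subY i : (i <= m)%N -> is_subgroup (Y i).
  rewrite leq_eqVlt => /predU1P[->|/sY[[]] //]; rewrite Ym; exact: subgroupT.
have Ymono i j : (i <= j <= m)%N -> Y i `<=` Y j.
  case/andP=> /subnK <-; elim: (j - i)%N => [_ x //|k IHk lek].
  apply: subset_trans (IHk (ltnW lek)) _.
  by have [[_ [sub _]] _] := sY _ lek.
have [i [idxi nsub]] : exists i, i \in idx /\ ~ (Y i.+1 `&` W `<=` Y i).
  apply: contrapT => bad.
  pose a i := #|imG w (Y i)|.
  have mono_a i j : (i <= j <= m)%N -> (a i <= a j)%N.
    move=> ij; have [/andP[leij lejm]] := (ij, Ymono i j ij).
    move=> sYij; apply/subset_leq_card/fintype.subsetP=> y.
    have sYi := subY i (leq_trans leij lejm).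
    by case/(mem_imG wi _ sYi)=> x Yx <-; apply: imG_in (subY j lejm) _ => //; apply: sYij.
  have lt_a i : i \in idx -> (a i < a i.+1)%N.
    move=> ii; have [lim _] := idxP i ii.
    have sYi := subY i (ltnW lim); have sYi1 := subY i.+1 lim.
    have sub_i : Y i.+1 `&` W `<=` Y i.
      by apply: contrapT => nsub; apply: bad; exists i.
    have [_ [[sYY nYY] _]] := sY i lim.
    apply/proper_card/properP; split.
      apply/fintype.subsetP=> y /(mem_imG wi _ sYi)[x Yx <-].
      by apply: imG_in => //; apply: sYY.
    apply: contrapT => all; apply: nYY => x Yx; apply: contrapT => nYx; apply: all.
    exists (w x); first exact: imG_in.
    apply/negP=> /(mem_imG wi _ sYi)[y Yy wxy]; apply: nYx.
    rewrite -(mulKVg y x); apply: sYi.2.1 => //; apply: sub_i; split.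
      by apply: sYi1.2.1 => //; apply: sYi1.2.2; apply: sYY.
    by apply/wker; case: (wi) => wM _ _; rewrite wM (finite_imageV wi) wxy mulVg.
  have a_inj : {in idx &, injective a}.
    move=> i j ii jj aij; have [lim _] := idxP i ii; have [ljm _] := idxP j jj.
    case: (ltngtP i j) => // [lij | lji].
      have := leq_trans (lt_a i ii) (mono_a i.+1 j _).
      by rewrite lij (ltnW ljm) aij ltnn => /(_ isT).
    have := leq_trans (lt_a j jj) (mono_a j.+1 i _).
    by rewrite lji (ltnW lim) aij ltnn => /(_ isT).
  have ua : uniq (map a idx) by rewrite map_inj_in_uniq.
  have /(uniq_leq_size ua) : {subset map a idx <= iota 1 #|wT|}.
    by move=> _ /mapP[j _ ->]; rewrite mem_iota /= add1n ltnS max_card cardG_gt0.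
  by rewrite size_map size_iota leqNgt szidx.
have [lim [cT [T [CT [phi [phiM [phiT phiker]]]]]]] := idxP i idxi.
(* In this quotient both the series above [N] and the subgroup [W] are full preimages. *)
have nNW : open_normal (N `&` W) by apply: open_normalI.
have [gT [f [fi fker]]] := open_normal_finite_image HG nNW.
pose B j := imG f (Y j); pose Wb := imG f W.
have nB j : (j < m)%N -> B j <| B j.+1.
  by move=> ljm; apply: (imG_normal fi); [apply: subY | have [] := sY j ljm].
have snB j : (j <= m)%N -> B j <|<| [set: gT]%SET.
  move=> lejm; rewrite -(subKn lejm); elim: (m - j)%N => [|k IHk].
    by rewrite subn0 /B Ym (imGT fi) subnormal_refl.
  have [ltmk | lekm] := leqP m k.
    by rewrite subnS (_ : m - k = 0)%N // in IHk *; apply/eqP; rewrite subn_eq0.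
  have eqk : ((m - k.+1).+1 = m - k)%N := subnSK lekm.
  apply: subnormal_trans (normal_subnormal (nB _ _)) _; rewrite eqk //.
  exact: leq_subr.
have kerY j : (j <= m)%N -> forall x, f x = 1 -> Y j x.
  by move=> lejm x /fker[Nx _]; apply: (Ymono 0%N) => //; rewrite Y0.
have sYi := subY i (ltnW lim); have sYi1 := subY i.+1 lim.
have isoT : B i.+1 / B i \isog T.
  apply: (@isog_same_kernel _ (Y i.+1) _ _ (coset (B i) \o f) phi) => //.
  - have nBi := fintype.subsetP (normal_norm (nB i lim)).
    have [fM _ _] := fi.
    by move=> x y Yx Yy /=; rewrite fM morphM // nBi // (imG_in fi).
  - move=> y; split.
      case/morphimP=> _ _ /(mem_imG fi _ sYi1)[x Yx <-] ->; by exists x.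
    by case=> x Yx <- /=; rewrite mem_quotient // (imG_in fi).
  move=> x Yx; rewrite phiker //=; split.
    move/coset_idr=> Bx; apply: (imG_full fi sYi (kerY i (ltnW lim))); apply: Bx.
    by rewrite (fintype.subsetP (normal_norm (nB i lim))) // (imG_in fi).
  by move=> Yix; rewrite coset_id // (imG_in fi).
have simB : simple (B i.+1 / B i) by rewrite (isog_simple isoT) HC.
have nWb : Wb <| [set: gT]%SET by apply: (imG_normalT fi); case: nW.
pose X := (B i.+1 :&: Wb)%G.
have nXB : X <| B i.+1.
  by apply: normalGI nWb; rewrite finset.subsetT.
have nsX : ~~ (X \subset B i).
  apply/negP=> sXB; apply: nsub => x [Yx Wx].
  apply: (imG_full fi sYi (kerY i (ltnW lim))); apply: (fintype.subsetP sXB).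
  by rewrite finset.inE !(imG_in fi) //; case: nW => [[]].
have isoX := simple_factor_restrict (nB i lim) simB nXB nsX.
have simX : simple (X / (B i :&: X)) by rewrite -(isog_simple isoX).
have nX'X : B i :&: X <| X.
  by rewrite finset.setIC; apply: normalGI (nB i lim); apply: finset.subsetIl.
have snX : X <|<| [set: gT]%SET.
  exact: subnormal_trans (normal_subnormal nXB) (snB i.+1 lim).
have [K [L [chKL _ sKW powK]]] := chief_factor_of_section nWb (normal1 _) (sub1G _)
  snX (finset.subsetIr _ _) (sub1G _) nX'X simX.
have [fiL minK KP] := chief_factor_image fi chKL.
exists _, (coset L \o f), (K / L)%G; split=> //.
  exists cT, T; split=> //; apply: direct_power_isog powK.
  by apply: isog_trans isoT; rewrite isog_sym.
move=> x /KP Kx; apply: (imG_full fi).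
- by case: nW => [[]].
- by move=> y /fker[].
exact: (fintype.subsetP sKW).
Qed.

End ClassChiefFactors.

(** * Residuals *)

Lemma direct_power_nontrivial (gT hT : finGroupType) (F : {group gT}) (H : {group hT}) :
  direct_power F H -> F :!=: 1 -> exists2 E : {group gT}, E \subset F & E \isog H.
Proof.
move=> [[|k] [Fi [defF isoF]]] ntF; first by rewrite -defF big_ord0 eqxx in ntF.
by exists (Fi ord0); [apply: normal_sub (direct_power_component defF _) |].
Qed.

Lemma direct_power_pgroup (p : nat) (gT hT : finGroupType) (F : {group gT}) (H : {group hT}) :
  direct_power F H -> p.-group H -> p.-group F.
Proof.
move=> [k [Fi [defF isoF]]] pH; rewrite /pgroup -(bigdprod_card defF).
apply: (big_ind (fun n => p.-nat n)) => // [m n pm pn | i _]; first by rewrite pnatM pm.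
by rewrite (card_isog (isoF i)).
Qed.

Lemma pgroup_of_elts (p : nat) (gT : finGroupType) (A : {group gT}) : prime p ->
  (forall y, y \in A -> exists m, p.-nat m /\ y ^+ m = 1) -> p.-group A.
Proof.
move=> p_pr Ap; apply/pgroupP=> q q_pr /(Cauchy q_pr)[y Ay oy].
have [m [pm ym]] := Ap y Ay; have: (q %| m)%N by rewrite -oy order_dvdn ym.
by move=> q_m; have := pnat_dvd q_m pm; rewrite pnatE.
Qed.

Section Residuals.

Variable G : topGroupType.
Hypothesis HG : profinite G.
Hypothesis Hji : just_infinite G.

Lemma subgroupX (T : set G) x n : is_subgroup T -> T x -> T (x ^+ n).
Proof. by move=> [T1 [TM _]] Tx; elim: n => [|n IHn] //; rewrite expgS; apply: TM. Qed.

Lemma subgroup_coprime_exp (T : set G) x m n : is_subgroup T -> coprime m n ->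
  T (x ^+ m) -> T (x ^+ n) -> T x.
Proof.
move=> sT; have [->|n_gt0] := posnP n.
  by rewrite /coprime gcdn0 => /eqP-> //.
move=> co_mn Tm Tn; have [a _ /dvdnP[b eqb]] := Bezoutl m n_gt0.
have eqab : (1 + a * m = b * n)%N by rewrite -eqb -(eqP co_mn) gcdnC.
have -> : x = x ^+ (b * n) * (x ^+ (a * m))^-1 by rewrite -eqab expgD expg1 mulgK.
by apply: sT.2.1; [|apply: sT.2.2]; rewrite mulnC expgM; apply: subgroupX.
Qed.

(** [U / V] is a [pi]-group, said through powers of elements; [V] is normal in all of [G].
    Accordingly [residual pi U] stands for [O^pi(U)]. *)
Definition quotient_exponent (pi : nat_pred) (U V : set G) : Prop :=
  [/\ open_normal V, V `<=` U
    & forall x, U x -> exists m, pi.-nat m /\ V (x ^+ m)].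

Definition residual pi (U : set G) : set G :=
  [set x | forall V, quotient_exponent pi U V -> V x].

Variable U : set G.
Hypothesis nU : open_normal U.

Lemma quotient_exponent_refl pi : quotient_exponent pi U U.
Proof. by split=> // x Ux; exists 1%N; rewrite expg1. Qed.

Lemma quotient_exponentI pi V V' : quotient_exponent pi U V ->
  quotient_exponent pi U V' -> quotient_exponent pi U (V `&` V').
Proof.
move=> [nV sV VP] [nV' sV' VP']; split; first exact: open_normalI.
  by move=> x [/sV].
move=> x Ux; have [m [pm Vm]] := VP x Ux; have [n [pn Vn]] := VP' x Ux.
exists (m * n)%N; rewrite pnatM pm pn; split=> //; split.
  by rewrite expgM; apply: subgroupX Vm; case: nV => [[]].
by rewrite mulnC expgM; apply: subgroupX Vn; case: nV' => [[]].
Qed.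

Lemma residual_sub_open pi (O : set G) : open O -> residual pi U `<=` O ->
  exists2 V, quotient_exponent pi U V & V `<=` O.
Proof.
move=> oO sO; apply: contrapT => nV.
have [] := @directed_common_point _ HG
  [set A | exists2 V, quotient_exponent pi U V & A = V `&` ~` O].
- by exists (U `&` ~` O), U; [apply: quotient_exponent_refl |].
- move=> _ [V [nVV _ _] ->]; apply: closedI; last exact: open_closedC.
  exact: open_normal_closed.
- move=> _ [V qV ->]; apply: contrapT => V0; apply: nV; exists V => // x Vx.
  by apply: contrapT => nOx; apply: V0; exists x.
- move=> _ _ [V qV ->] [V' qV' ->]; exists (V `&` V' `&` ~` O).
    by exists (V `&` V') => //; apply: quotient_exponentI.
  by move=> x [[Vx V'x] nOx].
move=> x xP; have [_ nOx] : (U `&` ~` O) x.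
  by apply: xP; exists U => //; apply: quotient_exponent_refl.
apply/nOx/sO => V qV; have [] // : (V `&` ~` O) x by apply: xP; exists V.
Qed.

(** The residual is closed and normal, so if nontrivial it is open, and by compactness it is then
    one of the subgroups [V] that it is the intersection of. *)
Lemma residual_cases pi : residual pi U = @trivial_set G \/
  quotient_exponent pi U (residual pi U).
Proof.
have [->|ntR] := pselect (residual pi U = @trivial_set G); [by left | right].
have nR : Defs.normal_sub (residual pi U).
  split; first split.
  - by move=> V [[[[]]]].
  - split=> [x y Rx Ry V qV | x Rx V qV]; have [[[[_ [VM VV]] _] _] _ _] := qV.
      by apply: VM; [apply: Rx | apply: Ry].
    by apply: VV; apply: Rx.
  split=> // k h _ Rh V qV; have [[[_ [_ nV]] _] _ _] := qV; apply: nV => //; exact: Rh.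
have cR : closed (residual pi U).
  have -> : residual pi U = \bigcap_(V in quotient_exponent pi U) V by [].
  by apply: closed_bigI => V [nV _ _]; apply: open_normal_closed.
have oR : open (residual pi U).
  by apply: (closed_finite_index_open HG) => //; [case: nR | apply: Hji.2].
have [V qV sV] := residual_sub_open oR (fun x => id).
suff <- : V = residual pi U by [].
by apply/seteqP; split=> // x Rx; apply: Rx.
Qed.

(** A trivial residual makes [U] pro-[p]: every open normal subgroup of [U] then contains some [V]
    with [U / V] a [p]-group. *)
Lemma residual_p_nontrivial (p : nat) : prime p -> ~ virtually_pro_p G p ->
  quotient_exponent p U (residual p U).
Proof.
move=> p_pr nvp; case: (residual_cases p) => // R1; case: nvp.
have [nUs oU] := nU; have sU := nUs.1.
exists U; split; first by [].
move=> N nN oN; have sN := nN.1.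
have [||V [nV sVU VP] sVN] := @residual_sub_open p N;
  [exact: oN | by rewrite R1 => _ ->; case: sN |].
have [gT [f [fi fker]]] := open_normal_finite_image HG nV.
have [fM _ _] := fi.
pose A := imG f U; pose B := imG f N.
have nBA : B <| A by apply: imG_normal.
have pA : p.-group A.
  apply: pgroup_of_elts => // y /(mem_imG fi _ sU)[x Ux <-].
  have [m [pm Vm]] := VP x Ux; exists m; split=> //.
  by rewrite -(finite_imageX fi); apply/fker.
have: p.-nat #|A : B| by apply: pnat_dvd pA; apply: dvdn_indexg.
case/p_natP=> k idx_k; exists k.
have /choice[g gP] (D : {set gT}) : exists x, D \in lcosets B A -> U x /\ f x *: B = D.
  case: (pselect (D \in lcosets B A)) => [/lcosetsP[y Ay ->]|nD]; last by exists 1.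
  by have [x Ux <-] := (mem_imG fi _ sU).1 Ay; exists x.
exists (map g (enum (lcosets B A))).
have szs : size (map g (enum (lcosets B A))) = (p ^ k)%N.
  by rewrite size_map -cardE card_lcosets idx_k.
have mem_l D : (D \in enum (lcosets B A)) = (D \in lcosets B A) by rewrite mem_enum.
have kerN x : f x = 1 -> N x by move/fker/sVN.
split=> //; split; first by move=> x /mapP[D]; rewrite mem_l => /gP[Ux _] ->.
split.
  move=> h Uh; have lD : f h *: B \in lcosets B A.
    by apply/lcosetsP; exists (f h); rewrite // (imG_in fi).
  exists (g (f h *: B)); first by apply/map_f; rewrite mem_l.
  have [Ug eqg] := gP _ lD; apply: (imG_full fi sN kerN).
  by rewrite fM (finite_imageV fi) -mem_lcoset eqg lcoset_refl.
move=> i j lti ltj; rewrite -szs size_map in lti ltj.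
rewrite !(nth_map finset.set0) // => Nij.
have li : nth finset.set0 (enum (lcosets B A)) i \in lcosets B A by rewrite -mem_l mem_nth.
have lj : nth finset.set0 (enum (lcosets B A)) j \in lcosets B A by rewrite -mem_l mem_nth.
have [_ ei] := gP _ li; have [_ ej] := gP _ lj.
apply/eqP; rewrite -(nth_uniq finset.set0 lti ltj) ?enum_uniq //; apply/eqP.
rewrite -{1}ei -{1}ej; apply/lcoset_eqP.
by rewrite mem_lcoset -groupV invgM invgK -(finite_imageV fi) -fM (imG_in fi).
Qed.

End Residuals.

(** * A chief factor in the class that is not centralised *)

Section NonCentralChiefFactor.

Variable G : topGroupType.
Hypothesis HG : profinite G.
Variable C : group_class.
Hypothesis HC : forall (gT : finGroupType) (T : {group gT}), C T -> simple T.
Hypothesis Hji : just_infinite G.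
Hypothesis Hnvp : forall p : nat, prime p -> ~ virtually_pro_p G p.
Hypothesis Hstar : cond_starstar G C.

Section CentralContradiction.

Variable U : set G.
Hypothesis nU : open_normal U.

Hypothesis cenU : forall (gT : finGroupType) (f : G -> gT) (F : {group gT}),
  finite_image f -> minnormal F [set: gT]%SET -> class_power C F ->
  (forall x, f x \in F -> U x) ->
  forall u x, U u -> f x \in F -> [~ f u, f x] = 1.

Let sU : is_subgroup U := nU.1.1.

Definition class_prime (p : nat) : Prop :=
  prime p /\ exists (cT : finGroupType) (K : {group cT}), C K /\ #|K| = p.

Lemma central_class_power_abelian (gT : finGroupType) (f : G -> gT) (F : {group gT}) :
  finite_image f -> minnormal F [set: gT]%SET -> class_power C F ->
  (forall x, f x \in F -> U x) -> abelian F.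
Proof.
move=> fi minF powF sFU; apply/centsP=> a Fa b Fb; apply/commgP/eqP.
have [_ fs _] := fi; case: (fs a) (fs b) => [x fx] [y fy].
by rewrite -fx -fy; apply: (cenU fi minF powF sFU); rewrite ?fy //; apply: sFU; rewrite fx.
Qed.

(** Induction on the order of the image [E] of [T = O^p(U)], so that no [p]-chief factor lies above
    [F] in [E]. Then [F] meets [O^p(E)] trivially by [central_p_residual], whereas [O^p(E) = E]. *)
Lemma no_p_chief_in_residual (p : nat) (gT : finGroupType) (f : G -> gT) (F : {group gT}) :
    class_prime p -> finite_image f -> minnormal F [set: gT]%SET -> p.-group F ->
  ~ (forall x, f x \in F -> residual p U x).
Proof.
move=> [p_pr [cT [T0 [CT0 oT0]]]].
have qT := residual_p_nontrivial HG Hji nU p_pr (Hnvp p_pr).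
set T := residual p U in qT *; have [nT sTU TP] := qT; have sT : is_subgroup T := nT.1.1.
move: {2}#|_| (leqnn #|imG f T|) => n; elim: n gT f F => [|n IHn] gT f F.
  by rewrite leqNgt cardG_gt0.
move=> len fi minF pF sFT.
have [fM fs _] := fi.
have /mingroupP[/andP[ntF nFT] _] := minF.
have nF : F <| [set: gT]%SET by rewrite /normal finset.subsetT.
have powF : class_power C F.
  have [H [sHF simH powH]] := charsimple_direct_power (minnormal_charsimple minF).
  have pH := pgroupS sHF pF.
  have H_pr := simple_sol_prime (pgroup_sol pH) simH.
  have oH : #|H| = p by move: pH; rewrite /pgroup pnatE // => /eqP.
  exists cT, T0; split=> //; apply: direct_power_isog powH.
  have cH : cyclic H by apply: prime_cyclic.
  have cT0 : cyclic T0 by apply: prime_cyclic; rewrite oT0.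
  by rewrite isog_cyclic_card // cT0 oH oT0 eqxx.
pose E := imG f T.
have nE : E <| [set: gT]%SET by apply: (imG_normalT fi); case: nT.
have sFE : F \subset E.
  by apply/fintype.subsetP=> y; have [x <-] := fs y; move/sFT/(imG_in fi sT).
have kT x : f x = 1 -> T x by move=> fx; apply: sFT; rewrite fx group1.
have sFU x : f x \in F -> U x by move/sFT/sTU.
have cFE : F \subset 'Z(E).
  rewrite finset.subsetI sFE; apply/centsP=> a Fa b /(mem_imG fi _ sT)[y Ty <-].
  have [x fx] := fs a; apply/esym/commgP/eqP; rewrite -fx.
  by apply: (cenU fi minF powF sFU (sTU _ Ty)); rewrite fx.
have FD1 : F :&: p_residual p E = 1.
  apply: central_p_residual => // X X' sFX' nX'X snX simX.
  have snXT : X <|<| [set: gT]%SET := subnormal_trans snX (normal_subnormal nE).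
  have [K [L [chKL sFL sKE powK]]] :=
    chief_factor_of_section nE nF sFE snXT (subnormal_sub snX) sFX' nX'X simX.
  have [fiL minK KP] := chief_factor_image HG fi chKL.
  have /andP[maxL nK] := chKL; have /andP[ltLK nLT] := maxgroupp maxL.
  have ntK : (K / L)%G :!=: 1 by have /mingroupP[/andP[]] := minK.
  have KT x : (coset L \o f) x \in K / L -> T x.
    by move/KP=> Kx; apply: (imG_full fi sT kT); apply: (fintype.subsetP sKE).
  split=> [oX | nabX schurX].
    (* A factor of order [p] above [F] gives a [p]-chief factor in a quotient where the image of [T]
       is smaller. *)
    apply: (IHn _ (coset L \o f) (K / L)%G) => //; last first.
      by apply: direct_power_pgroup powK _; rewrite /pgroup oX pnat_id.
    have imL : imG (coset L \o f) T \subset E / L.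
      apply/fintype.subsetP=> y /(mem_imG fiL _ sT)[x Tx <-] /=.
      by rewrite mem_quotient // (imG_in fi).
    rewrite -ltnS; apply: leq_trans len; apply: leq_ltn_trans (subset_leq_card imL) _.
    apply: ltn_quotient; last by rewrite (fintype.subset_trans (proper_sub ltLK)).
    by apply: contraNneq ntF => L1; rewrite -subG1 -L1.
  (* The factor belongs to the class by the Schur condition, so the chief factor it gives is
     abelian: a contradiction. *)
  have [dT [D [CD isoD]]] := Hstar.2 p p_pr (ex_intro _ cT (ex_intro _ T0 (conj CT0 oT0)))
    _ (X / X')%G simX nabX schurX.
  have powC : class_power C (K / L)%G by exists dT, D; split=> //; apply: direct_power_isog powK.
  have abK := central_class_power_abelian fiL minK powC (fun x Kx => sTU x (KT x Kx)).
  have [H sHK isoH] := direct_power_nontrivial powK ntK.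
  by case/negP: nabX; rewrite -(isog_abelian isoH) (abelianS sHK).
pose D := p_residual_group p E.
have nD : D <| [set: gT]%SET.
  by rewrite /normal finset.subsetT p_residual_norm // normal_norm.
have sDE : D \subset E := p_residual_sub p E.
have nDE : D <| E := normalS sDE (finset.subsetT E) nD.
have pED : p.-group (E / D) by apply: p_residual_quotient.
(* [U / T] and [E / D] are [p]-groups, so the preimage of [D] is among the subgroups whose
   intersection is [T]; hence [E = D]. *)
have qV : quotient_exponent p U [set x | f x \in D].
  split; first exact: preim_open_normal.
    by move=> x /= /(fintype.subsetP sDE) Ex; apply: sTU; apply: (imG_full fi sT kT).
  move=> x Ux; have [m [pm Tm]] := TP x Ux.
  pose q := #[coset D (f (x ^+ m))]; exists (m * q)%N.
  have Em : f (x ^+ m) \in E by apply: imG_in.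
  have Nm : f (x ^+ m) \in 'N(D) by rewrite (fintype.subsetP (normal_norm nDE)).
  rewrite pnatM pm /=; split.
    by apply: mem_p_elt pED _; rewrite mem_quotient.
  rewrite /= expgM (finite_imageX fi (x ^+ m) q); apply: coset_idr; first exact: groupX.
  by rewrite morphX // expg_order.
have sED : E \subset D.
  by apply/fintype.subsetP=> y /(mem_imG fi _ sT)[x Tx <-]; apply: (Tx _ qV).
case/negP: ntF; rewrite -FD1 eq_sym; apply/eqP/finset.setIidPl.
exact: fintype.subset_trans sFE sED.
Qed.

(** [W] contains a chief factor in the class; it is abelian, hence a [p]-group for a prime [p] of
    the class, and it lies in [O^p(U)]. *)
Lemma central_no_deep (W : set G) : open_normal W -> W `<=` U ->
  ~ (forall p, class_prime p -> W `<=` residual p U).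
Proof.
move=> nW sWU sWR.
have [gT [f [F [fi minF powF sFW]]]] := class_chief_below HG HC Hstar nW.
have sFU x : f x \in F -> U x by move/sFW/sWU.
have abF := central_class_power_abelian fi minF powF sFU.
have [cT [T0 [CT0 powT0]]] := powF.
have ntF : F :!=: 1 by have /mingroupP[/andP[]] := minF.
have [H sHF isoH] := direct_power_nontrivial powT0 ntF.
have abT0 : abelian T0 by rewrite -(isog_abelian isoH) (abelianS sHF).
have pr_T0 := simple_sol_prime (abelian_sol abT0) (HC CT0).
have clp : class_prime #|T0| by split=> //; exists cT, T0.
apply: (no_p_chief_in_residual clp fi minF).
  by apply: direct_power_pgroup powT0 _; rewrite /pgroup pnat_id.
by move=> x /sFW; apply: sWR.
Qed.

Lemma central_contradiction : False.
Proof.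
have res_sub p : class_prime p -> quotient_exponent p U (residual p U).
  by move=> [p_pr _]; apply: residual_p_nontrivial => //; apply: Hnvp.
have [[p0 cp0 nUp0]|allU] := pselect (exists2 p, class_prime p & ~ U `<=` residual p U); last first.
  apply: (@central_no_deep U) => // p cp; apply: contrapT => nsub.
  by apply: allU; exists p.
have [nT0 sT0 T0P] := res_sub p0 cp0; have p0_pr := cp0.1.
have sT0g : is_subgroup (residual p0 U) := nT0.1.1.
(* If the [p0']-residual is trivial, some [V] inside [O^p0(U)] has [U / V] a [p0']-group. Then
   [U / O^p0(U)] is both a [p0]-group and a [p0']-group, hence trivial, against the choice of
   [p0]. *)
case: (residual_cases HG Hji nU (negn p0)) => [R1 | [nY sY YP]].
  have [||V [nV sV VP] sVT] := @residual_sub_open _ HG U nU (negn p0) (residual p0 U).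
  - by case: nT0.
  - by rewrite R1 => _ ->; case: sT0g.
  apply: nUp0 => x Ux; have [m [pm Vm]] := VP x Ux; have [n [pn Tn]] := T0P x Ux.
  apply: (@subgroup_coprime_exp G (residual p0 U) x n m) => //; first exact: pnat_coprime pn pm.
  exact: sVT.
(* For [p != p0] a [p]-quotient is a [p0']-quotient, so the [p0']-residual lies in [O^p(U)]: one
   open intersection serves infinitely many primes. *)
apply: (@central_no_deep (residual (negn p0) U `&` residual p0 U)).
- exact: open_normalI.
- by move=> x [/sY].
move=> p cp x [Yx Tx]; have [->//|neqp] := eqVneq p p0.
have [nT sT TP] := res_sub p cp; apply: Yx; split=> // y Uy.
have [m [pm Tm]] := TP y Uy; exists m; split=> //.
apply: sub_in_pnat pm => q _; rewrite !inE => /eqP->.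
by [].
Qed.

End CentralContradiction.

Lemma noncentral_class_chief (U : set G) : open_normal U ->
  exists (gT : finGroupType) (f : G -> gT) (F : {group gT}),
    [/\ finite_image f, minnormal F [set: gT]%SET, class_power C F,
        forall x, f x \in F -> U x
      & exists u x, [/\ U u, f x \in F & [~ f u, f x] != 1]].
Proof.
move=> nU; apply: contrapT => nex; apply: (central_contradiction nU).
move=> gT f F fi minF powF sFU u x Uu Fx; apply: contrapT => ncom; apply: nex.
by exists gT, f, F; split=> //; exists u, x; split=> //; apply/eqP.
Qed.

End NonCentralChiefFactor.

(** * Critical pairs *)

Section Series.

Variable G : topGroupType.
Hypothesis HG : profinite G.
Variable C : group_class.
Hypothesis HC : forall (gT : finGroupType) (T : {group gT}), C T -> simple T.
Hypothesis Hji : just_infinite G.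
Hypothesis Hnvp : forall p : nat, prime p -> ~ virtually_pro_p G p.
Hypothesis Hstar : cond_starstar G C.

Lemma just_infinite_open (H : set G) :
  closed_normalised [set: G] H -> H <> @trivial_set G -> open H.
Proof.
by move=> [sH cH nH] ntH; apply: (closed_finite_index_open HG) => //; apply: Hji.2.
Qed.

Definition class_critical (A B : set G) : Prop :=
  [/\ critical_pair A B, open_normal A, open_normal B & direct_power_of_class C A B].

(** Let [F] be a noncentral chief factor in an image [f], with preimage inside both [V] and [S]. A
    closed normal [A] minimal subject to not lying in the kernel [L] of [f], and contained in the
    preimage of [F], maps onto [F]; minimality makes [A] and its intersection with [L] a critical
    pair. *)
Lemma class_critical_below (S : set G) : open_normal S ->
  exists A B, [/\ class_critical A B, A `<=` S & cent_mod B A `<=` S].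
Proof.
move=> nS.
have [V nV VP] := obliquity HG just_infinite_open nS.1.1 nS.2.
have nU : open_normal (V `&` S) by apply: open_normalI.
have [gT [f [F [fi minF powF sFU [u [x0 [Uu Fx0 ncom]]]]]]] :=
  noncentral_class_chief HG HC Hji Hnvp Hstar nU.
have [fM fs _] := fi.
have /mingroupP[/andP[ntF nFT] minF'] := minF.
have nF : F <| [set: gT]%SET by rewrite /normal finset.subsetT.
have nK := preim_open_normal HG fi nF.
have n1 := preim_open_normal HG fi (normal1 [set: gT]%G).
set K := [set x | f x \in F] in nK; set L := [set x | f x \in _] in n1.
have LE x : L x <-> f x = 1 by rewrite /L /=; split=> [/set1P | ->]; rewrite ?group1.
have cn N : open_normal N -> closed_normalised [set: G] N.
  move=> nN; split; [by case: nN => [[]] | exact: open_normal_closed |].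
  by case: nN => [[_ []]].
have nsKL : ~ K `<=` L.
  move=> sKL; case/negP: ntF; rewrite -subG1; apply/fintype.subsetP=> y.
  by have [x <-] := fs y; move/sKL/LE => ->; rewrite group1.
have [A [cA nAL minA] sAK] :=
  minimal_outside_exists HG just_infinite_open n1.1.1 n1.2 (cn _ nK) nsKL.
have [sA clA nA] := cA.
have nAs : Defs.normal_sub A by [].
have oA : open A := closed_normalised_open just_infinite_open n1.1.1 cA nAL.
have nAo : open_normal A by [].
have nB : open_normal (A `&` L) by apply: open_normalI.
exists A, (A `&` L).
have imA : imG f A :=: F.
  apply: minF'.
    have /andP[_ ->] := imG_normalT fi nAs; rewrite andbT.
    apply/negP=> /eqP A1; apply: nAL => x Ax; apply/LE/eqP.
    by have := imG_in fi sA Ax; rewrite A1 => /set1P->.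
  by apply/fintype.subsetP=> y /(mem_imG fi _ sA)[x Ax <-]; apply: sAK.
have crit : critical_pair A (A `&` L).
  split; first by [].
  split; first by split; [case: nB | exact: open_normal_closed].
  split; first by split=> [x [] // | sAB]; apply: nAL => x /sAB[].
  move=> N [nN cN] [sNA nAN] x Nx; split; first exact: sNA.
  have [sNL|nNL] := pselect (N `<=` L); first exact: sNL.
  case: nAN; rewrite (minA N) //; by case: nN => sN [_ nN'].
have AR g x : A x -> A [~ g, x].
  by move=> Ax; rewrite commgEr; apply: sA.2.1 => //; apply: nA => //; apply: sA.2.2.
have centE : cent_mod (A `&` L) A = [set g | f g \in 'C(F)].
  apply/seteqP; split=> g.
    move=> cg; apply/centP=> y; rewrite -imA => /(mem_imG fi _ sA)[x Ax <-].
    apply/commgP/eqP; rewrite -(finite_imageR fi); apply/LE.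
    by case: (cg x Ax).
  move=> /= cg x Ax; split; first exact: AR.
  apply/LE; rewrite (finite_imageR fi); apply/eqP/commgP/(centP cg).
  by rewrite -imA (imG_in fi).
have nC : open_normal (cent_mod (A `&` L) A).
  rewrite centE; apply: (preim_open_normal HG fi (A := 'C(F)%G)).
  by rewrite /normal finset.subsetT norms_cent.
split.
- split=> //; have [cT [T [CT [k [Fi [defF isoF]]]]]] := powF.
  exists cT, T; split=> //; exists gT, F, k, Fi; split=> //; split=> //.
  exists f; split; first by move=> x y _ _; apply: fM.
  split; first by move=> t; rewrite -imA; apply: mem_imG.
  by move=> x Ax; split=> [/LE // | [_ /LE]].
- by move=> x /sAK/sFU[].
(* By obliquity the centraliser lies in [S] or contains [V], but [u] in [V] does not centralise
   [F]. *)
have [//|sVC] := VP _ (cn _ nC).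
case/negP: ncom; apply/commgP.
have: cent_mod (A `&` L) A u by apply: sVC; case: Uu.
by rewrite centE => /= /centP/(_ _ Fx0).
Qed.

(** [extra] records a relation between consecutive pairs: [True] in the just infinite case, the
    dichotomy of [hji_step] in the hereditary one. *)
Lemma class_series (extra : set G -> set G -> set G -> set G -> Prop) :
    (forall A B, class_critical A B -> exists A' B',
       [/\ class_critical A' B', A' `<=` B, cent_mod B' A' `<=` B & extra A B A' B']) ->
  exists R S : nat -> set G, good_series C R S /\
    forall n, extra (R n) (S n) (R n.+1) (S n.+1).
Proof.
move=> next.
pose st := {p : set G * set G | class_critical p.1 p.2}.
have [A0 [B0 [crit0 _ _]]] := class_critical_below (open_normalT G).
have step (p : st) : exists q : st, [/\ (sval q).1 `<=` (sval p).2,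
    cent_mod (sval q).2 (sval q).1 `<=` (sval p).2
    & extra (sval p).1 (sval p).2 (sval q).1 (sval q).2].
  case: p => [[A B] /= crit]; have [A' [B' [crit' s1 s2 ex]]] := next A B crit.
  by exists (exist _ (A', B') crit').
have /choice[nx nxP] := step.
pose p n := iter n nx (exist _ (A0, B0) crit0).
pose R n := (sval (p n)).1; pose S n := (sval (p n)).2.
have crit n : class_critical (R n) (S n) := svalP (p n).
have sRS n : R n.+1 `<=` S n by case: (nxP (p n)).
have cRS n : cent_mod (S n.+1) (R n.+1) `<=` S n by case: (nxP (p n)).
have cpair n : critical_pair (R n) (S n) by case: (crit n).
have nS n : open_normal (S n) by case: (crit n).
have clS n : closed (S n) by apply: open_normal_closed.
have decS n : S n.+1 `<=` S n.
  by apply: subset_trans (sRS n); have [_ [_ [[]]]] := cpair n.+1.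
have sS n : is_subgroup (S n) by case: (nS n) => [[]].
(* Otherwise the intersection has finite index and the chain stalls, so some [R n.+1], lying in
   [S n], lies in [S n.+1]. *)
have capS : \bigcap_n S n = @trivial_set G.
  apply: contrapT => nt.
  have nI : Defs.normal_sub (\bigcap_n S n).
    split; first split; first by move=> n _; case: (sS n).
    - split=> [x y Sx Sy n _ | x Sx n _]; have [_ [SM SV]] := sS n.
        by apply: SM; [apply: Sx | apply: Sy].
      by apply: SV; apply: Sx.
    split=> // k h _ Sh n _; have [[_ [_ nSn]] _] := nS n; apply: nSn => //; exact: Sh.
  have cI : closed (\bigcap_n S n) by apply: closed_bigI => n _.
  have [||||n sn] := @subgroup_descent_stops _ (\bigcap_n S n) S => //.
  - exact: Hji.2.
  - by move=> n x; apply.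
  have [_ [_ [[_ nRS] _]]] := cpair n.+1.
  by apply: nRS; apply: subset_trans (sRS n) sn.
have S1 g : (forall n, S n.+1 g) -> g = 1.
  move=> Sg; suff: (\bigcap_n S n) g by rewrite capS.
  by move=> n _; apply: decS.
exists R, S; split; last by move=> n; case: (nxP (p n)).
split=> //; split=> //; split=> //; split; last split; last split.
- split=> //; split; last split.
  + move=> c cP; apply: (@nested_common_point _ HG (fun n => [set g | S n.+1 ((c n)^-1 * g)])) => n.
    * exact: closed_lcoset.
    * by exists (c n); rewrite /= mulVg; case: (sS n.+1).
    move=> g /= Sg; have [_ [SM _]] := sS n.+1.
    have -> : (c n)^-1 * g = ((c n)^-1 * c n.+1) * ((c n.+1)^-1 * g).
      by rewrite -mulgA mulKVg.
    by apply: SM => //; apply: decS.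
  + by move=> n; case: (nS n.+1).
  move=> U oU U1; apply: contrapT => nU.
  have [|||g gP] := @nested_common_point _ HG (fun n => S n.+1 `&` ~` U).
  + by move=> n; apply: closedI => //; exact: open_closedC.
  + move=> n; apply: contrapT => n0; apply: nU; exists n => x Sx.
    by apply: contrapT => nUx; apply: n0; exists x.
  + by move=> n x [Sx nUx]; split=> //; apply: decS.
  have g1 : g = 1 by apply: S1 => n; case: (gP n).
  by case: (gP 0%N) => _; apply; rewrite g1.
- move=> n; have [[nR _] [[nSn _] [ltSR minR]]] := cpair n; split=> //; split=> //.
  split=> //; split=> // N nN sN ltN; apply: minR => //; split=> //.
  apply: (open_subgroup_closed HG); first by case: nN.
  by apply: (subgroup_open_of_sub HG (nS n.+1).2) => //; [case: (sS n.+1) | case: nN].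
- by move=> n; case: (crit n).
move=> n _ [a Ra [b Cb <-]]; apply: (sS n).2.1; first exact: sRS.
exact: cRS.
Qed.

End Series.

(** * Hereditarily just infinite groups *)

Section HereditarilyJustInfinite.

Variable G : topGroupType.
Hypothesis HG : profinite G.
Variable C : group_class.
Hypothesis HC : forall (gT : finGroupType) (T : {group gT}), C T -> simple T.
Hypothesis Hji : just_infinite G.
Hypothesis Hnvp : forall p : nat, prime p -> ~ virtually_pro_p G p.
Hypothesis Hstar : cond_starstar G C.

Lemma finite_index_trans (K H : set G) : finite_index_in K H ->
  finite_index_in H [set: G] -> finite_index_in K [set: G].
Proof.
move=> [t tP] [s sP]; exists [seq x * y | x <- s, y <- t] => g _.
have [x sx Hx] := sP g I; have [y ty Ky] := tP _ Hx.
by exists (x * y); [apply: allpairs_f | rewrite invgM -mulgA].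
Qed.

Lemma centraliser_closed_normal (R : set G) : Defs.normal_sub R ->
  closed_normal [set g : G | forall r, R r -> [~ g, r] = 1].
Proof.
move=> [_ [_ nR]].
have commE (g r : G) : [~ g, r] = 1 <-> r ^ g = r.
  rewrite commgEr conjVg; split=> [e | ->]; last by rewrite mulVg.
  by apply: (mulgI (r ^ g)^-1); rewrite mulVg e.
split; last first.
  have -> : [set g : G | forall r, R r -> [~ g, r] = 1] =
      \bigcap_(r in R) (fun g => [~ g, r]) @^-1` (@trivial_set G) by [].
  apply: closed_bigI => r _.
  by apply: (continuous_closedP _).1 (closed_trivial HG); apply: comm_continuous.
split; [split; [|split] | split=> //].
- by move=> r _; apply/commE; rewrite conjg1.
- move=> x y cx cy r Rr; apply/commE; rewrite conjgM.
  by rewrite ((commE _ _).1 (cx r Rr)) ((commE _ _).1 (cy r Rr)).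
- move=> x cx r Rr; apply/commE.
  by rewrite -{1}((commE _ _).1 (cx r Rr)) conjgK.
move=> k h _ ch r Rr; rewrite -[r](conjgKV k) -conjRg ch ?conj1g //.
exact: nR.
Qed.

(** If [H] meets [R] nontrivially, the intersection is normal in the just infinite group [R]. If
    trivially, [H] centralises [R], so the centraliser [Z] of [R] is open; then [Z] centralises
    every chief factor inside its intersection with [R], against [noncentral_class_chief]. *)
Lemma hereditarily_open (R : set G) : hereditarily_just_infinite G ->
  open_normal R -> forall H, closed_normalised R H -> H <> @trivial_set G -> open H.
Proof.
move=> hji nR H [sH cH nH] ntH.
have [[sR [_ nRG]] oR] := nR.
have cR := open_normal_closed HG nR.
have sI : is_subgroup (H `&` R) by apply: subgroupI.
have [I1|ntI] := pselect (H `&` R = @trivial_set G); last first.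
  have nI : normal_in (H `&` R) R.
    split=> //; split=> [x [] // | k h Rk [Hh Rh]]; split; [exact: nH | exact: nRG].
  have cI : closed (H `&` R) by apply: closedI.
  have fin := (hji.2 R (conj sR oR)).2 _ nI cI ntI.
  have finG := finite_index_trans fin (open_finite_index HG sR oR).
  have oI := closed_finite_index_open HG sI cI finG.
  by apply: (subgroup_open_of_sub HG oI sI.1 sH) => x [].
exfalso; pose Z := [set g : G | forall r, R r -> [~ g, r] = 1].
have [nZ cZ] : closed_normal Z by apply: centraliser_closed_normal; case: nR.
have sHZ : H `<=` Z.
  move=> h Hh r Rr; suff: (H `&` R) [~ h, r] by rewrite I1.
  split.
    by rewrite commgEl; apply: sH.2.1; [apply: sH.2.2 | apply: nH].
  by rewrite commgEr; apply: sR.2.1 => //; apply: nRG => //; apply: sR.2.2.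
have ntZ : Z <> @trivial_set G.
  move=> Z1; apply: ntH; apply/seteqP; split=> x; first by move/sHZ; rewrite Z1.
  by move=> ->; case: sH.
have oZ : open Z.
  by apply: (closed_finite_index_open HG) => //; [case: nZ | apply: Hji.2].
have nA : open_normal (Z `&` R) by apply: open_normalI.
have [gT [f [F [fi _ _ sFA [u [x [[Zu _] Fx ncom]]]]]]] :=
  noncentral_class_chief HG HC Hji Hnvp Hstar nA.
have [_ Rx] := sFA x Fx.
by case/negP: ncom; rewrite -(finite_imageR fi) Zu // (finite_image1 fi).
Qed.

Definition maximal_normal_in (R M : set G) : Prop :=
  [/\ normal_in M R, M `<` R
    & forall M', normal_in M' R -> M `<=` M' -> M' `<` R -> M' = M].

(** Obliquity relative to one member [M1] gives [V]: any other member either lies in [M1], hence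
    equals it, or contains [V]. So the intersection contains that of [M1] and [V]. *)
Lemma maximal_normals_cap_open (R : set G) :
    hereditarily_just_infinite G -> open_normal R ->
  let O := [set x | forall M, maximal_normal_in R M -> open M -> M x] in
  is_subgroup O /\ open O.
Proof.
move=> hji nR O.
have sO : is_subgroup O.
  split; first by move=> M [[[]]].
  split=> [x y Ox Oy M mM oM | x Ox M mM oM]; have [[[_ [MM MV]] _] _ _] := mM.
    by apply: MM; [apply: Ox | apply: Oy].
  by apply: MV; apply: Ox.
split=> //.
have [[M1 mM1 oM1]|noM] := pselect (exists2 M, maximal_normal_in R M & open M); last first.
  rewrite (_ : O = setT); first exact: openT.
  by apply/seteqP; split=> // x _ M mM oM; case: noM; exists M.
have [nM1 ltM1 maxM1] := mM1.
have [V nV VP] := obliquity HG (hereditarily_open hji nR) nM1.1 oM1.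
apply: (subgroup_open_of_sub HG (openI oM1 nV.2)) => //.
  by split; [case: nM1 => [[]] | case: nV => [[[]]]].
move=> x [M1x Vx] M mM oM; have [[sM [sMR nM]] ltM maxM] := mM.
have cM : closed_normalised R M by split=> //; apply: (open_subgroup_closed HG).
have [sMM1|] := VP M cM; last exact.
by rewrite -(maxM M1).
Qed.

(** Obliquity for [A], relative to the intersection [O] of its open maximal normal subgroups, gives
    [V]. With the next pair and its centraliser inside [V], an [H] not inside [O] contains both. *)
Lemma hji_step (A B : set G) : hereditarily_just_infinite G ->
  class_critical C A B -> exists A' B',
  [/\ class_critical C A' B', A' `<=` B, cent_mod B' A' `<=` B
    & forall H, is_subgroup H -> B' `<=` H -> normalised_by A H ->
      setmul A' (cent_mod B' A') `<=` H \/
      forall M, maximal_normal_in A M -> B' `<=` M -> H `<=` M].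
Proof.
move=> hji [_ nA nB _].
have [sO oO] := maximal_normals_cap_open hji nA.
have [V nV VP] := obliquity HG (hereditarily_open hji nA) sO oO.
have [A' [B' [crit sA' sC']]] :=
  class_critical_below HG HC Hji Hnvp Hstar (open_normalI nV nB).
exists A', B'; split=> //; [by move=> x /sA'[] | by move=> x /sC'[] |].
move=> H sH sBH nH; have [_ _ [[sB' _] oB'] _] := crit.
have open_up K : is_subgroup K -> B' `<=` K -> open K.
  by move=> sK sBK; apply: (subgroup_open_of_sub HG oB') => //; case: sB'.
have cH : closed_normalised A H.
  by split=> //; apply: (open_subgroup_closed HG) => //; apply: open_up.
have [sHO|sVH] := VP H cH; [right | left].
  move=> M mM sBM x Hx; apply: sHO => //; apply: open_up => //.
  by case: mM => [[]].
move=> _ [a A'a [b Cb <-]]; apply: sH.2.1; apply: sVH.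
  by case: (sA' _ A'a).
by case: (sC' _ Cb).
Qed.

Lemma maximal_normal_exists (R S : set G) :
    open_normal R -> open_normal S -> S `<` R ->
  exists2 M, maximal_normal_in R M & S `<=` M.
Proof.
move=> [nR oR] nS [sSR nRS]; have sR := nR.1.
have [gT [f [fi fker]]] := open_normal_finite_image HG nS.
have [fM fs _] := fi.
pose A := imG f R.
have ntA : A :!=: 1.
  apply/negP=> /eqP A1; apply: nRS => x Rx; apply/fker/eqP.
  by have := imG_in fi sR Rx; rewrite A1 => /set1P->.
have [B maxB] := ex_maxnormal_ntrivg ntA.
have ltBA := maxnormal_proper maxB; have /andP[sBA nBA] := maxnormal_normal maxB.
have kerR x : f x = 1 -> R x by move/fker/sSR.
have preB x : f x \in B -> R x.
  by move/(fintype.subsetP sBA); apply: (imG_full fi).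
have sM : is_subgroup [set x | f x \in B].
  split; first by rewrite /= (finite_image1 fi) group1.
  by split=> [x y|x] /=; rewrite ?fM ?(finite_imageV fi) ?groupV; [apply: groupM |].
exists [set x | f x \in B]; last by move=> x /fker /= ->.
split.
- split=> //; split=> // k h Rk /= Bh; rewrite (finite_imageJ fi) memJ_norm //.
  by rewrite (fintype.subsetP nBA) // (imG_in fi).
- split=> // sRB; have /proper_subn/negP := ltBA; apply.
  by apply/fintype.subsetP=> y /(mem_imG fi _ sR)[x Rx <-]; apply: sRB.
move=> M' [sM' [sM'R nM']] sMM' [_ nRM'].
have kerM' x : f x = 1 -> M' x by move=> fx; apply: sMM'; rewrite /= fx group1.
have defB : imG f M' :=: B.
  have /maxgroupP[_] := maxB; apply.
    have /andP[sM'A ->] := imG_normal fi sR (conj sM' (conj sM'R nM')).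
    rewrite andbT properE sM'A; apply/negP=> sAM'; apply: nRM' => x Rx.
    by apply: (imG_full fi sM' kerM'); apply: (fintype.subsetP sAM'); apply: imG_in.
  apply/fintype.subsetP=> y; have [x <-] := fs y; move=> Bx.
  by apply: (imG_in fi) => //; apply: sMM'.
apply/seteqP; split=> // x M'x /=; rewrite -defB.
exact: imG_in.
Qed.

(** Each factor contains [K] and commutes with the others modulo [K], so every generator of [N]
    normalises it. *)
Lemma commuting_family_normal (K N : set G) (Hs : seq (set G)) :
    (forall H, H \in Hs -> is_subgroup H /\ K `<=` H) ->
    gen (K `|` \bigcup_(H in [set H | H \in Hs]) H) = N ->
    (forall i j, (i < size Hs)%N -> (j < size Hs)%N -> i <> j ->
       forall x y, nth set0 Hs i x -> nth set0 Hs j y -> K [~ x, y]) ->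
  forall H, H \in Hs -> normalised_by N H.
Proof.
move=> HsP genN comH H HsH g h Ng Hh.
have [sH sKH] := HsP H HsH; have [H1 [HM HV]] := sH.
(* Requiring the condition for [g] and its inverse makes [nz] a subgroup. *)
pose nz := [set g : G | forall h, H h -> H (h ^ g) /\ H (h ^ g^-1)].
have HJ x y : H x -> H y -> H (x ^ y).
  by move=> Hx Hy; rewrite conjgE; apply: (HM); [apply: (HV) | apply: (HM)].
have sub_nz (D : set G) : is_subgroup D -> (forall x y, H x -> D y -> H (x ^ y)) -> D `<=` nz.
  by move=> [_ [_ DV]] DJ y Dy x Hx; split; apply: DJ => //; apply: DV.
suff: nz g by case/(_ h Hh).
move: Ng; rewrite -genN; apply.
  split; first by move=> x Hx; rewrite invg1 conjg1.
  split=> [x y nx ny z Hz | x nx z Hz].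
    rewrite invgM !conjgM; split; first exact: (ny _ (nx z Hz).1).1.
    exact: (nx _ (ny z Hz).2).2.
  by rewrite invgK; case: (nx z Hz).
have nzH : H `<=` nz by apply: sub_nz.
move=> y [/sKH/nzH // | [D /= HsD Dy]].
have [sD sKD] := HsP D HsD.
have [eqDH|neqDH] := pselect (D = H); first by apply: nzH; rewrite -eqDH.
move: y Dy; apply: sub_nz => // x y Hx Dy.
have -> : x ^ y = x * [~ x, y] by rewrite commgEl mulKVg.
apply: (HM) => //; apply: sKH.
apply: (comH (index H Hs) (index D Hs)); rewrite ?index_mem ?nth_index //.
by move=> eqi; apply: neqDH; rewrite -(nth_index set0 HsD) -eqi nth_index.
Qed.

(** Some factor [H] is not inside a maximal normal subgroup [M] of [R n]. It is normalised by [R n],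
    so it contains [R n.+1] and its centraliser modulo [S n.+1]. The other factors commute with [H],
    hence lie in that centraliser, and [H] is all of [N]. *)
Lemma hji_no_central_decomposition (R S : nat -> set G) :
    (forall n, open_normal (R n)) -> (forall n, open_normal (S n)) ->
    (forall n, S n.+1 `<` R n) -> hji_property R S ->
  no_central_decomposition R S.
Proof.
move=> nR nS ltSR hjiRS n N nN sRN [Hs [HsP [genN comH]]].
have [M [nM ltM maxM] sSM] := maximal_normal_exists (nR n) (nS n.+1) (ltSR n).
have HsP' H : H \in Hs -> is_subgroup H /\ S n.+1 `<=` H by case/HsP=> ? [].
have genS D : is_subgroup D -> S n.+1 `<=` D -> (forall H, H \in Hs -> H `<=` D) -> N `<=` D.
  move=> sD sSD HsD g; rewrite -genN => /(_ D sD); apply=> x [/sSD // | [H /= HsH Hx]].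
  exact: HsD HsH x Hx.
have [H HsH nHM] : exists2 H, H \in Hs & ~ H `<=` M.
  apply: contrapT => allM; apply: ltM.2; apply: subset_trans sRN _.
  apply: genS => //; first by case: nM.
  by move=> H HsH; apply: contrapT => nHM; apply: allM; exists H.
have [sH [sSH [sHN nNH]]] := HsP H HsH.
have nH := commuting_family_normal HsP' genN comH HsH.
have sPC : setmul (R n.+1) (cent_mod (S n.+1) (R n.+1)) `<=` H.
  have [//|HM] := hjiRS n H sH sSH (fun k h Rk => nH k h (sRN k Rk)).
  by case: nHM; apply: HM.
have [[[R1 _] _] _] := nR n.+1; have [[[S1 _] _] _] := nS n.+1.
have sPH : R n.+1 `<=` H.
  move=> x Rx; apply: sPC; exists x => //; exists 1; rewrite ?mulg1 // => y _.
  by rewrite comm1g.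
apply: nNH; apply: genS => // D HsD.
have [-> //|neqDH] := pselect (D = H).
move=> y Dy; apply: sPC; exists 1 => //; exists y; rewrite ?mul1g // => x Rx.
apply: (comH (index D Hs) (index H Hs)); rewrite ?index_mem ?nth_index //; last exact: sPH.
by move=> eqi; apply: neqDH; rewrite -(nth_index set0 HsD) eqi nth_index.
Qed.

End HereditarilyJustInfinite.

Theorem theorem9 (G : topGroupType) (C : group_class)
  (HG : profinite G)
  (HC : forall (gT : finGroupType) (T : {group gT}), C gT T -> simple T)
  (Hji : just_infinite G)
  (Hnvp : forall p : nat, prime p -> ~ virtually_pro_p G p)
  (Hstar : cond_starstar G C) :
  (exists R S : nat -> set G, good_series C R S) /\
  (hereditarily_just_infinite G ->
     exists R S : nat -> set G,
       good_series C R S /\ hji_property R S /\ no_central_decomposition R S).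
Proof.
split=> [|hji].
  have [A B [_ _ nB _]|R [S [goodRS _]]] :=
      @class_series _ HG C HC Hji Hnvp Hstar (fun _ _ _ _ => True); last by exists R, S.
  have [A' [B' [crit sA' sC']]] := class_critical_below HG HC Hji Hnvp Hstar nB.
  by exists A', B'.
have [R [S [goodRS extra]]] := class_series HG HC Hji Hnvp Hstar
  (fun A B crit => hji_step HG HC Hji Hnvp Hstar hji crit).
exists R, S; split=> //.
have hjiRS : hji_property R S.
  move=> n H sH sSH nH; have [?|HM] := extra n H sH sSH nH; [by left | right].
  by move=> M nM sSM ltM maxM; apply: HM.
split=> //.
have [cpair [sRS [_ [[_ [_ [oS _]]] _]]]] := goodRS.
have sSR n : S n.+1 `<` R n.+1 by have [_ [_ []]] := cpair n.+1.
have sSS n : S n.+1 `<=` S n by apply: subset_trans (sRS n); case: (sSR n).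
have sSRn n : S n `<` R n by have [_ [_ []]] := cpair n.
(* [inverse_limit_iso] gives openness of [S n.+1] only; [S 0] and the [R n] are open because they
   contain such a subgroup. *)
have open_up A n : Defs.normal_sub A -> S n.+1 `<=` A -> open_normal A.
  move=> nA sSA; split=> //; apply: (subgroup_open_of_sub HG (oS n)) => //; last by case: nA.
  by have [_ [[[[]]]]] := cpair n.+1.
have ltSR n : S n.+1 `<` R n.
  have [sSR' nRS] := sSRn n; split; first exact: subset_trans (sSS n) sSR'.
  by move=> sRSn; apply: nRS; apply: subset_trans sRSn (sSS n).
apply: (hji_no_central_decomposition HG) => // n.
  by apply: (open_up _ n); [have [[]] := cpair n | case: (ltSR n)].
by apply: (open_up _ n) => //; have [_ [[]]] := cpair n.
Qed.
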